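(* For each $r>0$, there is no functorial computable reduction from $\operatorname{FD}_r$ to $\operatorname{TFAb}_1$; that is, there are no Turing functionals $\Phi,\Phi_*$ such that $\Phi$ is a Turing-computable embedding of $\operatorname{FD}_r$ into $\operatorname{TFAb}_1$ and $(\Phi,\Phi_* )$ is a computable functor.
   Context: All structures are countable with universe $\omega$, identified with their atomic diagrams in $2^\omega$. $\operatorname{FD}_r$ is the class of fields of characteristic $0$ and transcendence degree $r$ over $\mathbb{Q}$; $\operatorname{TFAb}_1$ is the class of torsion-free abelian groups of rank $1$. A Turing-computable embedding of $K$ into $K'$ is a Turing operator $\Phi$ taking structures of $K$ to structures of $K'$ with $\mathcal{A}\cong\mathcal{B}$ iff $\Phi(\mathcal{A})\cong\Phi(\mathcal{B})$. A computable functor $(\Phi,\Phi_* )$ from $K$ to $K'$ requires additionally that for every isomorphism $f:\mathcal{B}\to\mathcal{B}'$ in $K$, $\Phi_*^{\mathcal{B}\oplus f\oplus\mathcal{B}'}$ is an isomorphism $\Phi(\mathcal{B})\to\Phi(\mathcal{B}')$, with this assignment respecting composition and preserving identities. *)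

(* Defs.v *)
From mathcomp Require Import all_boot all_algebra.
From mathcomp Require Import mpoly.

Set Implicit Arguments.
Unset Strict Implicit.
Unset Printing Implicit Defensive.

Import GRing.Theory.

Inductive move := Left | Stay | Right.

(* As in Soare: one work tape over {blank = false, 1 = true} and a read-only oracle tape.
   [delta] returning [None] means that the machine halts. The [option bool]
   argument is the scanned oracle cell: cell p >= 0 of the oracle tape holds
   X(p), and the cells to the left of cell 0 are blank ([None]). *)
Record oracle_machine := OracleMachine {
  state : finType;
  start : state;
  delta : state -> option bool -> bool -> option (state * bool * move * move)
}.

(* (left part read from the head outwards, scanned cell, right part);
   all the cells beyond the two lists are blank. *)
Definition tape : Type := seq bool * bool * seq bool.

Definition move_tape (m : move) (t : tape) : tape :=
  let: (l, c, r) := t in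
  match m with
  | Left => (behead l, head false l, c :: r)
  | Stay => (l, c, r)
  | Right => (c :: l, head false r, behead r)
  end.

Definition shift (m : move) : int :=
  match m with Left => (-1)%R | Stay => 0%R | Right => 1%R end.

Record config (M : oracle_machine) := Config {
  cstate : state M;
  ctape : tape;
  opos : int  (* position of the head on the oracle tape *)
}.

Definition oracle_cell (X : nat -> bool) (p : int) : option bool :=
  if p is Posz n then Some (X n) else None.

Definition step (M : oracle_machine) (X : nat -> bool) (c : config M) :
    option (config M) :=
  let: (l, b, r) := ctape c in
  if delta (cstate c) (oracle_cell X (opos c)) b is Some (q, b', mw, mo) then
    Some (Config q (move_tape mw (l, b', r)) (opos c + shift mo)%R)
  else None.

(* Input n: n+1 consecutive 1s, the head on the leftmost one. *)
Definition init (M : oracle_machine) (n : nat) : config M :=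
  Config (start M) ([::], true, nseq n true) 0%R.

(* Output: the total number of 1s on the work tape. *)
Definition output (M : oracle_machine) (c : config M) : nat :=
  let: (l, b, r) := ctape c in count id l + b + count id r.

Fixpoint run (M : oracle_machine) (X : nat -> bool) (k : nat) (c : config M) :
    option nat :=
  if step X c is Some c' then
    if k is k'.+1 then run X k' c' else None
  else Some (output c).

(* M^X(n) = y *)
Definition computes_at (M : oracle_machine) (X : nat -> bool) (n y : nat) :=
  exists k, run X k (init M n) = Some y.

(* M^X is total and equal to g *)
Definition computes (M : oracle_machine) (X : nat -> bool) (g : nat -> nat) :=
  forall n, computes_at M X n (g n).

Definition join (X Y : nat -> bool) (n : nat) : bool :=
  if odd n then Y n./2 else X n./2.

(* The Goedel numberings below are the [pickle] functions of the library, which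
   are primitive recursive on the types involved; [pickle_inv n = Some x] iff
   n is the number of x. *)

(* A function f : nat -> nat as an oracle: its graph {<a, b> | f a = b}. *)
Definition graph (f : nat -> nat) (n : nat) : bool :=
  if @pickle_inv (nat * nat)%type n is Some (a, b) then f a == b else false.

(* A finite language without relation symbols: symbol number i is a function
   symbol of arity L`_i (a constant if the arity is 0). *)
Definition language := seq nat.

Definition symbol_of (L : language) (i k : nat) : bool :=
  (i < size L) && (nth 0 L i == k).

(* [interp A i args] is meaningful only if symbol i of L has arity [size args];
   nothing below depends on its other values. *)
Record structure (L : language) := Structure {
  interp : nat -> seq nat -> nat
}.

(* Closed terms with names for the elements of omega: [Leaf a] is the name
   of a, and [Node i ts] is the symbol i applied to ts. *)
Definition term := GenTree.tree nat.

Fixpoint well_formed (L : language) (t : term) : bool :=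
  match t with
  | GenTree.Leaf _ => true
  | GenTree.Node i ts => symbol_of L i (size ts) && all (well_formed L) ts
  end.

Fixpoint eval (L : language) (A : structure L) (t : term) : nat :=
  match t with
  | GenTree.Leaf a => a
  | GenTree.Node i ts => interp A i (map (eval A) ts)
  end.

(* The atomic sentences are the equations between closed terms. *)
Definition diagram (L : language) (A : structure L) (n : nat) : bool :=
  if @pickle_inv (term * term)%type n is Some (s, t) then
    [&& well_formed L s, well_formed L t & eval A s == eval A t]
  else false.

Definition isomorphism (L : language) (A B : structure L) (f : nat -> nat) :=
  bijective f /\
  forall i args, symbol_of L i (size args) ->
    f (interp A i args) = interp B i (map f args).

Definition isomorphic (L : language) (A B : structure L) :=
  exists f, isomorphism A B f.

(* Phi(A) = B *)
Definition maps_to (L L' : language) (Phi : oracle_machine)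
    (A : structure L) (B : structure L') :=
  computes Phi (diagram A) (fun n => nat_of_bool (diagram B n)).

Definition turing_operator (L L' : language)
    (K : structure L -> Prop) (K' : structure L' -> Prop)
    (Phi : oracle_machine) :=
  forall A, K A -> exists2 B, K' B & maps_to Phi A B.

Definition turing_computable_embedding (L L' : language)
    (K : structure L -> Prop) (K' : structure L' -> Prop)
    (Phi : oracle_machine) :=
  turing_operator K K' Phi /\
  forall (A1 A2 : structure L) (B1 B2 : structure L'), K A1 -> K A2 ->
    maps_to Phi A1 B1 -> maps_to Phi A2 B2 ->
    (isomorphic A1 A2 <-> isomorphic B1 B2).

(* The oracle A (+) f (+) B *)
Definition arrow_oracle (L : language) (A : structure L) (f : nat -> nat)
    (B : structure L) : nat -> bool :=
  join (join (diagram A) (graph f)) (diagram B).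

(* Phi_*^{A (+) f (+) B} = g *)
Definition maps_arrow_to (L : language) (Phis : oracle_machine)
    (A : structure L) (f : nat -> nat) (B : structure L) (g : nat -> nat) :=
  computes Phis (arrow_oracle A f B) g.

Definition computable_functor (L L' : language)
    (K : structure L -> Prop) (K' : structure L' -> Prop)
    (Phi Phis : oracle_machine) :=
  [/\ turing_operator K K' Phi,
      forall (A1 A2 : structure L) f (B1 B2 : structure L'), K A1 -> K A2 ->
        isomorphism A1 A2 f -> maps_to Phi A1 B1 -> maps_to Phi A2 B2 ->
        exists2 g, maps_arrow_to Phis A1 f A2 g & isomorphism B1 B2 g,
      forall A g, K A -> maps_arrow_to Phis A id A g -> g =1 id
    & forall A1 A2 A3 f1 f2 g1 g2 g3, K A1 -> K A2 -> K A3 ->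
        isomorphism A1 A2 f1 -> isomorphism A2 A3 f2 ->
        maps_arrow_to Phis A1 f1 A2 g1 -> maps_arrow_to Phis A2 f2 A3 g2 ->
        maps_arrow_to Phis A1 (f2 \o f1) A3 g3 -> g3 =1 g2 \o g1].

(* The symbols 0, .., 4 are +, *, -, 0, 1. *)
Definition field_language : language := [:: 2; 2; 1; 0; 0].

(* e carries the structure A to the field F. *)
Definition presents_field (A : structure field_language) (F : fieldType)
    (e : nat -> F) : Prop :=
  [/\ bijective e,
      forall x y, e (interp A 0 [:: x; y]) = (e x + e y)%R,
      forall x y, e (interp A 1 [:: x; y]) = (e x * e y)%R,
      forall x, e (interp A 2 [:: x]) = (- e x)%R
    & e (interp A 3 [::]) = 0%R /\ e (interp A 4 [::]) = 1%R].

(* [mmap ratr (tnth x) p] is the value p(x_1, .., x_n); [ratr] is the embedding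
   of the rationals in F when F has characteristic 0. *)
Definition alg_independent (F : fieldType) (n : nat) (x : n.-tuple F) : Prop :=
  forall p : {mpoly rat[n]}, mmap ratr (tnth x) p = 0%R -> p = 0%R.

Definition trans_degree (F : fieldType) (r : nat) : Prop :=
  exists x : r.-tuple F, alg_independent x /\
    forall y : F, ~ alg_independent [tuple of rcons x y].

Definition FD (r : nat) (A : structure field_language) : Prop :=
  exists (F : fieldType) (e : nat -> F),
    [/\ presents_field A e, [pchar F]%R =i pred0 & trans_degree F r].

(* The symbols 0, 1, 2 are +, -, 0. *)
Definition group_language : language := [:: 2; 1; 0].

Definition presents_group (A : structure group_language) (V : zmodType)
    (e : nat -> V) : Prop :=
  [/\ bijective e,
      forall x y, e (interp A 0 [:: x; y]) = (e x + e y)%R,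
      forall x, e (interp A 1 [:: x]) = (- e x)%R
    & e (interp A 2 [::]) = 0%R].

Definition torsion_free (V : zmodType) : Prop :=
  forall (x : V) (n : nat), 0 < n -> (x *+ n = 0)%R -> x = 0%R.

Definition lin_independent (V : zmodType) (n : nat) (x : n.-tuple V) : Prop :=
  forall c : 'I_n -> int,
    (\sum_(i < n) tnth x i *~ c i = 0)%R -> forall i, c i = 0%R.

Definition has_rank (V : zmodType) (r : nat) : Prop :=
  exists x : r.-tuple V, lin_independent x /\
    forall y : V, ~ lin_independent [tuple of rcons x y].

Definition TFAb (r : nat) (A : structure group_language) : Prop :=
  exists (V : zmodType) (e : nat -> V),
    [/\ presents_group A e, torsion_free V & has_rank V r].

(* Main.v *)
(* A functor on isomorphisms extends to embeddings: an embedding j : A -> A' is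
   a pointwise limit of isomorphisms from copies of A' whose atomic diagrams
   converge to that of A, and the images of these isomorphisms stabilise because
   identities go to identities with a finite use. So bi-embeddable fields are
   sent to bi-embeddable torsion-free groups of rank 1, and such groups are
   isomorphic. It remains to find bi-embeddable fields of transcendence degree
   r > 0 that are not isomorphic. Let P(s) be the closure of Q(x, s) in the reals
   under square roots of 1 + y^2, where x, w are algebraically independent of
   total length r, and t = w^2. Then P(t) <= P(t)(w) <= P(w), and P(w) embeds
   into P(t) by w |-> t. In P(t) every 1 + y^2 is a square, but 1 + w^2 = 1 + t
   is not a square in P(t)(w): otherwise 1 + t or t (1 + t) would be a square in
   P(t), and mapping t to -2 - t^2, resp. to -1/(1 + t^2), would make a negative
   real a square. *)
From HB Require Import structures.
Require Import Defs.
From mathcomp Require Import all_boot.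
From mathcomp Require Import all_order all_algebra.
From mathcomp Require Import mpoly zify ring lra.
From mathcomp Require Import boolp Rstruct.
From mathcomp Require classical_sets.
From Stdlib Require Runcountable.

Set Implicit Arguments.
Unset Strict Implicit.
Unset Printing Implicit Defensive.
Import Order.TTheory GRing.Theory Num.Theory.

(** * Functors and embeddings *)

(** A halting run scans finitely many oracle cells, the last one when it halts. Any [u] beyond all
    head positions works, since cells left of 0 are blank for every oracle. *)
Lemma oracle_cell_use (M : oracle_machine) X k (c : config M) y :
  run X k c = Some y ->
  exists u, forall X', (forall n, n < u -> X' n = X n) -> run X' k c = Some y.
Proof.
elim: k c => [|k IHk] c.
  rewrite /=; case E: (step X c) => [//|] out.
  exists (absz (opos c)).+1 => X' eqX.
  suff ->: step X' c = step X c by rewrite E.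
  by rewrite /step; case: (opos c) eqX => //= n ->.
rewrite /=; case E: (step X c) => [c'|] out.
  have [u Hu] := IHk _ out.
  exists (maxn u (absz (opos c)).+1) => X' eqX.
  have ->: step X' c = step X c.
    rewrite /step; case: (opos c) eqX => //= n ->//.
    by rewrite leq_max ltnSn orbT.
  by rewrite E; apply: Hu => n ltnu; apply: eqX; rewrite leq_max ltnu.
exists (absz (opos c)).+1 => X' eqX.
suff ->: step X' c = step X c by rewrite E.
by rewrite /step; case: (opos c) eqX => //= n ->.
Qed.

Lemma computes_at_use (M : oracle_machine) X n y :
  computes_at M X n y ->
  exists u, forall X', (forall m, m < u -> X' m = X m) -> computes_at M X' n y.
Proof.
by case=> k /oracle_cell_use [u Hu]; exists u => X' /Hu Hk; exists k.
Qed.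

Lemma run_monotone (M : oracle_machine) X k k' (c : config M) y :
  k <= k' -> run X k c = Some y -> run X k' c = Some y.
Proof.
elim: k k' c => [|k IHk] [|k'] c //=; case: (step X c) => //= c' lekk'.
exact: IHk.
Qed.

Lemma computes_at_inj (M : oracle_machine) X n y y' :
  computes_at M X n y -> computes_at M X n y' -> y = y'.
Proof.
case=> k Hk [k' Hk']; apply: Some_inj.
rewrite -(run_monotone (leq_maxl k k') Hk).
exact: (run_monotone (leq_maxr k k') Hk').
Qed.

(** The structure is pulled back along the permutation [f] with inverse [g], so [f] is an
    isomorphism from the copy to [A]. *)
Definition copy (L : language) (A : structure L) (f g : nat -> nat) :
    structure L :=
  Structure L (fun i args => g (interp A i (map f args))).

Lemma copy_isomorphism (L : language) (A : structure L) f g :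
  cancel f g -> cancel g f -> isomorphism (copy A f g) A f.
Proof. by move=> fK gK; split=> [|i args _]; [exists g|rewrite /= gK]. Qed.

Lemma id_isomorphism (L : language) (A : structure L) : isomorphism A A id.
Proof. by split=> [|i args _]; [exists id|rewrite map_id]. Qed.

Lemma isomorphism_comp (L : language) (A B C : structure L) f g :
  isomorphism A B f -> isomorphism B C g -> isomorphism A C (g \o f).
Proof.
move=> [bij_f homf] [bij_g homg]; split; first exact: bij_comp.
by move=> i args Li /=; rewrite homf // homg ?size_map // map_comp.
Qed.

Lemma isomorphism_inv (L : language) (A B : structure L) f g :
  cancel f g -> cancel g f -> isomorphism A B f -> isomorphism B A g.
Proof.
move=> fK gK [_ homf]; split; first by exists f.
move=> i args Li; apply: (can_inj fK).
by rewrite gK homf ?size_map // -map_comp map_id_in // => x _ /=; rewrite gK.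
Qed.

(** * Approximation of embeddings by isomorphisms from copies *)

Definition embedding (L : language) (A B : structure L) (j : nat -> nat) :=
  injective j /\
  forall i args, symbol_of L i (size args) ->
    j (interp A i args) = interp B i (map j args).

Fixpoint leaf_bound (t : term) : nat :=
  match t with
  | GenTree.Leaf a => a
  | GenTree.Node _ ts => foldr maxn 0 (map leaf_bound ts)
  end.

(** At inner nodes [g] and [f] cancel, so [f] acts only on the leaves of [t], where it agrees with
    [j]. *)
Lemma eval_copy_agree (L : language) (A B : structure L) j f g N t :
  embedding A B j -> cancel f g -> cancel g f ->
  (forall a, a <= N -> f a = j a) -> leaf_bound t <= N -> well_formed L t ->
  f (eval (copy B f g) t) = j (eval A t).
Proof.
move=> [injj homj] fK gK eqfj.
(* Terms are nested trees: the recursion is on subterms, with an inner induction on the list of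
   arguments. *)
move: t; fix IH 1.
case=> [a|i ts] /=; first by move=> leN _; apply: eqfj.
move=> leN /andP[Li Lts].
rewrite gK homj ?size_map //; congr (interp B i _); rewrite -!map_comp.
elim: ts leN Lts {Li} => [|t ts IHts] //=.
rewrite geq_max => /andP[letN leN] /andP[Lt Lts].
by rewrite IHts // (IH t).
Qed.

Definition agree N (f j : nat -> nat) := forall a, a <= N -> f a = j a.

(** The sentences with number below [n] contain finitely many names, and the injectivity of [j]
    makes an equation true in [A] exactly when its image is true in [B]. *)
Lemma diagram_copy_agree (L : language) (A B : structure L) j n :
  embedding A B j ->
  exists N, forall f g, cancel f g -> cancel g f -> agree N f j ->
    forall m, m < n -> diagram (copy B f g) m = diagram A m.
Proof.
move=> embj; elim: n => [|n [N HN]]; first by exists 0.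
have [N' HN'] : exists N, forall f g, cancel f g -> cancel g f -> agree N f j ->
    diagram (copy B f g) n = diagram A n.
  rewrite /diagram; case: pickle_inv => [[s t]|]; last by exists 0.
  exists (maxn (leaf_bound s) (leaf_bound t)) => f g fK gK eqfj.
  case Ls: (well_formed L s) => //; case Lt: (well_formed L t) => //=.
  rewrite -(inj_eq (can_inj fK)).
  rewrite !(eval_copy_agree embj fK gK eqfj) ?leq_maxl ?leq_maxr //.
  by rewrite (inj_eq embj.1).
exists (maxn N N') => f g fK gK eqfj m; rewrite ltnS leq_eqVlt => /predU1P[->|].
  by apply: HN' => // a leaN; apply: eqfj; rewrite leq_max leaN orbT.
by apply: HN => // a leaN; apply: eqfj; rewrite leq_max leaN.
Qed.

Lemma graph_agree u :
  exists N, forall f j, agree N f j -> forall m, m < u -> graph f m = graph j m.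
Proof.
elim: u => [|u [N HN]]; first by exists 0.
have [N' HN'] : exists N, forall f j, agree N f j -> graph f u = graph j u.
  rewrite /graph; case: pickle_inv => [[a b]|]; last by exists 0.
  by exists a => f j ->.
exists (maxn N N') => f j eqfj m; rewrite ltnS leq_eqVlt => /predU1P[->|].
  by apply: HN' => a leaN; apply: eqfj; rewrite leq_max leaN orbT.
by apply: HN => a leaN; apply: eqfj; rewrite leq_max leaN.
Qed.

Lemma join_agree X X' Y Y' u :
  (forall m, m < u -> X m = X' m) -> (forall m, m < u -> Y m = Y' m) ->
  forall m, m < u -> join X Y m = join X' Y' m.
Proof.
move=> eqX eqY m ltmu; rewrite /join.
have ltm2u: m./2 < u by apply: leq_ltn_trans ltmu; rewrite -[leqRHS]odd_double_half -addnn addnA leq_addl.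
by rewrite eqX // eqY.
Qed.

(** The values are corrected one at a time: precomposing [f] with the transposition of [n] and
    [g (j n)] sets the value at [n] to [j n] and, as [j] is injective, keeps the earlier values. *)
Lemma permutation_agree (j : nat -> nat) N :
  injective j -> exists f g, [/\ cancel f g, cancel g f & agree N f j].
Proof.
move=> injj; rewrite /agree.
suff [f [g [fK gK eqfj]]]: exists f g : nat -> nat,
    [/\ cancel f g, cancel g f & forall a, a < N.+1 -> f a = j a].
  by exists f, g.
elim: N.+1 => [|n [f [g [fK gK eqfj]]]]; first by exists id, id.
pose b := g (j n).
pose s a := if a == n then b else if a == b then n else a.
have sK: involutive s.
  move=> a; rewrite /s; case: (eqVneq a n) => [->|an].
    by case: (eqVneq b n) => [->//|_]; rewrite eqxx.
  by case: (eqVneq a b) => [->|/negPf ab]; rewrite ?eqxx // (negPf an) ab.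
exists (f \o s), (s \o g); split=> [a|a|a] /=; rewrite ?fK ?sK ?gK //.
rewrite ltnS leq_eqVlt /s => /predU1P[->|ltan]; first by rewrite eqxx /b gK.
rewrite (ltn_eqF ltan); case: (eqVneq a b) => [ab|_]; last exact: eqfj.
have /injj an: j a = j n by rewrite -eqfj // ab /b gK.
by rewrite an ltnn in ltan.
Qed.

(** * Extension of a functor to embeddings *)

Section Functor.

Variables (L L' : language).
Variables (K : structure L -> Prop) (K' : structure L' -> Prop).
Variables (Phi Phis : oracle_machine).
Hypothesis functor : computable_functor K K' Phi Phis.
Hypothesis copyK : forall A f g, cancel f g -> cancel g f -> K A ->
  K (copy A f g).

(** The identity of [A] goes to the identity, and the computation of its value at [b] has a finite
    use. An oracle agreeing with that of the identity on this use gives the same value. *)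
Lemma functor_near_id A b : K A ->
  exists N, forall (A1 A2 : structure L) h k, (forall m, m < N -> diagram A1 m = diagram A m) ->
    (forall m, m < N -> diagram A2 m = diagram A m) -> agree N h id ->
    maps_arrow_to Phis A1 h A2 k -> k b = b.
Proof.
case: functor => opPhi iso_arrow id_arrow _ KA.
have [B K'B AB] := opPhi A KA.
have [g Ag _] := iso_arrow A A id B B KA KA (id_isomorphism A) AB AB.
have [u Hu] := computes_at_use (Ag b).
have [N HN] := graph_agree u.
exists (maxn u N) => A1 A2 h k eqA1 eqA2 hid Ak.
rewrite -[RHS](id_arrow A g KA Ag b).
apply: (computes_at_inj (Ak b)); apply: Hu.
have leuN m : m < u -> m < maxn u N by move=> ltmu; rewrite leq_max ltmu.
apply: join_agree => [m ltmu|m ltmu]; last exact/eqA2/leuN.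
apply: (@join_agree _ _ _ _ u) => // [m' ltmu'|m' ltmu'].
  exact/eqA1/leuN.
by apply: HN => // a leaN; apply: hid; rewrite leq_max leaN orbT.
Qed.

(** [J b] is the eventual value at [b] of the images of the isomorphisms [f] from [copy A2 f g] to
    [A2], as [f] approaches [j]. *)
Lemma functor_embedding A1 A2 j (B1 B2 : structure L') : K A1 -> K A2 -> embedding A1 A2 j ->
  maps_to Phi A1 B1 -> maps_to Phi A2 B2 -> exists J, embedding B1 B2 J.
Proof.
move=> KA1 KA2 embj AB1 AB2.
case: (functor) => opPhi iso_arrow id_arrow comp_arrow.
have arrow f g : cancel f g -> cancel g f ->
    exists B k, [/\ maps_to Phi (copy A2 f g) B,
      maps_arrow_to Phis (copy A2 f g) f A2 k & isomorphism B B2 k].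
  move=> fK gK; have Kc := copyK fK gK KA2.
  have [B _ cB] := opPhi _ Kc.
  have [k ck isok] :=
    iso_arrow _ _ _ _ _ Kc KA2 (copy_isomorphism A2 fK gK) cB AB2.
  by exists B, k.
(* Two such copies are related by [g' \o f], which is close to the identity between structures close
   to [A1]. Its image [l] fixes [b], and [k = k' \o l] by functoriality. *)
have stable b : exists N, forall f g f' g' k k',
    [/\ cancel f g, cancel g f & agree N f j] ->
    [/\ cancel f' g', cancel g' f' & agree N f' j] ->
    maps_arrow_to Phis (copy A2 f g) f A2 k ->
    maps_arrow_to Phis (copy A2 f' g') f' A2 k' -> k b = k' b.
  have [u Hu] := functor_near_id b KA1.
  have [N HN] := diagram_copy_agree u embj.
  exists (maxn u N) => f g f' g' k k' [fK gK eqf] [fK' gK' eqf'] ck ck'.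
  have eqN h : agree (maxn u N) h j -> agree N h j.
    by move=> eqh a lea; apply: eqh; rewrite leq_max lea orbT.
  have Kc := copyK fK gK KA2; have Kc' := copyK fK' gK' KA2.
  have isof := copy_isomorphism A2 fK gK.
  have isof' := copy_isomorphism A2 fK' gK'.
  have isoh := isomorphism_comp isof (isomorphism_inv fK' gK' isof').
  have [B _ cB] := opPhi _ Kc; have [B' _ cB'] := opPhi _ Kc'.
  have [l cl _] := iso_arrow _ _ _ _ _ Kc Kc' isoh cB cB'.
  have f'gf: f' \o (g' \o f) = f by apply: funext => a /=; rewrite gK'.
  have := comp_arrow _ _ _ _ _ l k' k Kc Kc' KA2 isoh isof' cl ck'.
  rewrite f'gf => /(_ ck) /= /(_ b) -> /=; congr (k' _).
  apply: Hu cl.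
  - exact: (HN _ _ fK gK (eqN _ eqf)).
  - exact: (HN _ _ fK' gK' (eqN _ eqf')).
  - move=> a lea; apply: (can_inj fK'); rewrite /= gK'.
    by rewrite eqf ?eqf' // leq_max lea.
have limit b : exists c, exists N, forall f g k,
    [/\ cancel f g, cancel g f & agree N f j] ->
    maps_arrow_to Phis (copy A2 f g) f A2 k -> k b = c.
  have [N HN] := stable b.
  have [f [g fgN]] := permutation_agree N embj.1.
  have [fK gK _] := fgN.
  have [B [k [_ ck _]]] := arrow f g fK gK.
  by exists (k b), N => f' g' k' fgN' ck'; apply: HN ck' ck.
have [J HJ] := choice limit.
(* A single isomorphism onto [B2] agrees with [J] on a given finite set, and its source agrees with
   [B1] on a given part of the diagram. *)
have near (s : seq nat) n : exists k (B : structure L'),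
   [/\ forall m, m < n -> diagram B m = diagram B1 m, isomorphism B B2 k
     & forall b, b \in s -> k b = J b].
  (* Finitely many bits of the diagram of [A1] determine the first [n] bits computed by [Phi], so
     copies close to [A1] go to structures close to [B1]. *)
  have use : exists u, forall X', (forall m, m < u -> X' m = diagram A1 m) ->
      forall m, m < n -> computes_at Phi X' m (diagram B1 m).
    elim: n => [|n [u Hu]]; first by exists 0.
    have [u' Hu'] := computes_at_use (AB1 n).
    exists (maxn u u') => X' eqX m.
    rewrite ltnS leq_eqVlt => /predU1P[->|].
      by apply: Hu' => m' ltm; apply: eqX; rewrite leq_max ltm orbT.
    by apply: Hu => m' ltm; apply: eqX; rewrite leq_max ltm.
  have [u Hu] := use.
  have [N HN] := diagram_copy_agree u embj.
  have [N' HN'] : exists N', forall f g k,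
      [/\ cancel f g, cancel g f & agree N' f j] ->
      maps_arrow_to Phis (copy A2 f g) f A2 k -> forall b, b \in s -> k b = J b.
    elim: s => [|b s [N1 HN1]]; first by exists 0.
    have [N2 HN2] := HJ b.
    exists (maxn N1 N2) => f g k [fK gK eqf] ck b'; rewrite inE => /predU1P[->|].
      by apply: HN2 ck; split=> // a lea; apply: eqf; rewrite leq_max lea orbT.
    by apply: HN1 ck _; split=> // a lea; apply: eqf; rewrite leq_max lea.
  have [f [g [fK gK eqf]]] := permutation_agree (maxn N N') embj.1.
  have [B [k [cB ck isok]]] := arrow f g fK gK.
  exists k, B; split=> // [m ltmn|].
    have eqN : agree N f j by move=> a lea; apply: eqf; rewrite leq_max lea.
    have := computes_at_inj (cB m) (Hu _ (HN f g fK gK eqN) m ltmn).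
    by do 2!case: (diagram _ m).
  by apply: HN' ck; split=> // a lea; apply: eqf; rewrite leq_max lea orbT.
exists J; split=> [b b' eqJ|i args Li].
  have [k [B [_ [bij_k _] kJ]]] := near [:: b; b'] 0.
  by apply: (bij_inj bij_k); rewrite !kJ ?inE ?eqxx ?orbT.
(* That the symbol [i] takes the value [d] at [args] is a single bit of the diagram, with number
   [m]. It therefore passes from [B1] to a nearby [B]. *)
pose d := interp B1 i args.
pose lhs : term := GenTree.Node i (map (@GenTree.Leaf nat) args).
pose m := pickle (lhs, GenTree.Leaf d : term).
have evalE (B : structure L') : diagram B m = (interp B i args == d).
  rewrite /diagram /m pickleK_inv /= size_map Li /=.
  rewrite -map_comp map_id_in //.
  by have ->: all (well_formed L') (map (@GenTree.Leaf nat) args)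
    by apply/allP => _ /mapP[a _ ->].
have [k [B [eqB [_ homk] kJ]]] := near (d :: args) m.+1.
have := eqB m (ltnSn m); rewrite !evalE eqxx => /eqP Bd.
rewrite -/d -kJ ?mem_head // -Bd homk //; congr (interp B2 i _).
by apply/eq_in_map => a aargs; rewrite kJ // inE aargs orbT.
Qed.

End Functor.

(** * Torsion-free abelian groups of rank 1 *)

Section RankOne.
Local Open Scope ring_scope.

(** This is the form in which rank 1 is used: two elements always have a common generator. *)
Definition locally_cyclic (V : zmodType) :=
  forall x y : V, exists z (a b : int), x = z *~ a /\ y = z *~ b.

Lemma torsion_free_mulrz (V : zmodType) (x : V) (m : int) :
  torsion_free V -> m != 0 -> x *~ m = 0 -> x = 0.
Proof.
move=> tfV; case: m => n n0; first by rewrite -pmulrn; apply: tfV; rewrite lt0n.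
by rewrite NegzE mulrNz => /eqP; rewrite oppr_eq0 => /eqP; apply: tfV.
Qed.

Lemma torsion_free_mulrzI (V : zmodType) (m : int) :
  torsion_free V -> m != 0 -> injective (fun x : V => x *~ m).
Proof.
move=> tfV m0 x y /= /eqP; rewrite -subr_eq0 -mulrzBl => /eqP.
by move/(torsion_free_mulrz tfV m0)/eqP; rewrite subr_eq0 => /eqP.
Qed.

(** For [x] nonzero there is a relation [p x = q y] with [q] nonzero. Torsion-freeness allows
    division by the gcd of [p] and [q], and the Bezout coefficients then give the generator
    [u y + w x]. *)
Lemma rank1_locally_cyclic (V : zmodType) :
  torsion_free V -> has_rank V 1 -> locally_cyclic V.
Proof.
move=> tfV [t [indt dept]].
set v := tnth t ord0.
have v0 m : v *~ m = 0 -> m = 0.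
  move=> vm; apply: (indt (fun=> m) _ ord0).
  by rewrite big_ord_recl big_ord0 addr0.
have mulv y : exists2 m : int, m != 0 & exists k : int, y *~ m = v *~ k.
  have [c /= cdep cn0] : exists2 c : 'I_2 -> int,
      \sum_(i < 2) tnth [tuple of rcons t y] i *~ c i = 0 &
      ~ (forall i, c i = 0).
    apply: contrapT => noc; apply: (dept y) => c cdep.
    by apply: contrapT => cn0; apply: noc; exists c.
  move: cdep; rewrite !big_ord_recl big_ord0 addr0.
  rewrite !(tnth_nth 0) /= !nth_rcons !size_tuple /=.
  have -> : nth 0 t 0 = v by rewrite /v (tnth_nth 0).
  set i1 := lift ord0 ord0 => cdep.
  exists (c i1); last first.
    by exists (- c ord0); rewrite mulrNz; apply/eqP; rewrite -addr_eq0 addrC cdep.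
  apply/eqP => c1; apply: cn0; move: cdep; rewrite c1 mulr0z addr0 => /v0 c0 i.
  case: i => [[|[|//]] lti] /=.
    by rewrite -c0; congr (c _); apply: val_inj.
  by rewrite -c1; congr (c _); apply: val_inj.
move=> x y; case: (eqVneq x 0) => [->|x0].
  by exists y, 0, 1; rewrite mulr0z mulr1z.
have [p [q [q0 pq]]] : exists p q : int, q != 0 /\ x *~ p = y *~ q.
  have [m m0 [k xm]] := mulv x; have [m' m'0 [k' ym]] := mulv y.
  exists (m * k'), (m' * k); split; last first.
    by rewrite !mulrzA xm ym mulrzAC.
  rewrite mulf_neq0 //; apply: contra_neq x0 => k0.
  by apply: (torsion_free_mulrz tfV m0); rewrite xm k0 mulr0z.
have [u [w uw]] := Bezoutz p q.
set g := gcdz p q in uw.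
have g0 : g != 0 by rewrite gcdz_eq0 negb_and q0 orbT.
have pE : p = (p %/ g)%Z * g by rewrite divzK // dvdz_gcdl.
have qE : q = (q %/ g)%Z * g by rewrite divzK // dvdz_gcdr.
have pq1 : x *~ (p %/ g)%Z = y *~ (q %/ g)%Z.
  by apply: (torsion_free_mulrzI tfV g0) => /=; rewrite -!mulrzA -pE -qE.
have uw1 : u * (p %/ g)%Z + w * (q %/ g)%Z = 1.
  by apply: (mulIf g0); rewrite mulrDl -!mulrA -pE -qE uw mul1r.
exists (y *~ u + x *~ w), (q %/ g)%Z, (p %/ g)%Z; rewrite !mulrzDl -!mulrzA.
split.
  rewrite [u * _]mulrC [y *~ _]mulrzA -pq1 -mulrzA -mulrzDr.
  by rewrite [_ * u]mulrC uw1 mulr1z.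
rewrite [w * _]mulrC [x *~ _]mulrzA pq1 -mulrzA -mulrzDr.
by rewrite [_ * w]mulrC uw1 mulr1z.
Qed.

(* For a subgroup [H] of a locally cyclic group [W], if the orders modulo [H]
   are bounded and [k] is the largest, then [H] = [kW]. *)
Lemma bounded_subgroup (W : zmodType) (H : W -> Prop) (n : nat) :
  locally_cyclic W -> (0 < n)%N ->
  (forall x y, H x -> H y -> H (x - y)) -> (forall x, H (x *+ n)) ->
  exists2 k : nat, (0 < k)%N & forall x, H x <-> exists y, x = y *+ k.
Proof.
move=> cycW n0 HB Hn.
have H0 : H 0 by rewrite -(mul0rn W n).
have HN x : H x -> H (- x) by move=> Hx; rewrite -sub0r; apply: HB.
have HD x y : H x -> H y -> H (x + y).
  by move=> Hx Hy; rewrite -[y]opprK; apply/HB/HN.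
have Hz x (m : int) : H x -> H (x *~ m).
  move=> Hx; have Hx' k : H (x *+ k).
    by elim: k => [|k IHk] //; rewrite mulrS; apply: HD.
  by case: m => m; rewrite ?NegzE ?mulrNz -pmulrn; [|apply: HN]; apply: Hx'.
pose ord x k := [/\ (0 < k)%N, H (x *+ k) &
  forall j, (0 < j)%N -> H (x *+ j) -> (k <= j)%N].
have ordP x : exists k, ord x k.
  have ex : exists k, `[< (0 < k)%N /\ H (x *+ k) >].
    by exists n; apply/asboolP.
  case: (ex_minnP ex) => k /asboolP[k0 Hk] kmin; exists k; split=> // j j0 Hj.
  by apply: kmin; apply/asboolP.
have ord_le x k : ord x k -> (k <= n)%N by case=> _ _; apply.
have [e [k [orde kmax]]] : exists e k, ord e k /\
    forall x j, ord x j -> (j <= k)%N.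
  have ex : exists k, `[< exists e, ord e k >].
    by have [k ordk] := ordP 0; exists k; apply/asboolP; exists 0.
  have bound k : `[< exists e, ord e k >] -> (k <= n)%N.
    by move/asboolP => [e /ord_le].
  case: (ex_maxnP ex bound) => k /asboolP[e orde] kmax.
  by exists e, k; split=> // x j ordj; apply: kmax; apply/asboolP; exists x.
(* A common generator [z] of [e] and [x] has order modulo [H] at least that of [e], hence the
   maximal order [k]. *)
have common x : exists z (m : int), x = z *~ m /\ ord z k.
  have [z [a [b [ez xz]]]] := cycW e x.
  exists z, b; split=> //.
  have [j ordj] := ordP z.
  suff -> : k = j by [].
  apply/eqP; rewrite eqn_leq (kmax _ _ ordj) andbT.
  case: orde => _ _; case: (ordj) => j0 Hj _; apply=> //.
  by rewrite ez pmulrn mulrzAC -pmulrn; apply: Hz.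
have [k0 _ _] := orde; exists k => // x; split=> [Hx|[y ->]]; last first.
  have [z [m [-> [_ Hzk _]]]] := common y.
  by rewrite pmulrn mulrzAC -pmulrn; apply: Hz.
have [z [m [xz [_ Hzk zmin]]]] := common x.
suff /dvdzP[q mq] : (k %| m)%Z.
  by exists (z *~ q); rewrite xz mq mulrzA -pmulrn.
apply/dvdz_mod0P.
(* The remainder of [m] modulo [k] also takes [z] into [H]; being smaller than the order [k] of [z],
   it is 0. *)
have Hr : H (z *~ (m %% k)%Z).
  have -> : (m %% k)%Z = m - (k%:Z * (m %/ k)%Z).
    by rewrite {2}(divz_eq m k) mulrC addrC addKr.
  rewrite mulrzBr -xz; apply: HB => //.
  by rewrite mulrzA; apply: Hz; rewrite -pmulrn.
have k0' : k%:Z != 0 by rewrite eqz_nat -lt0n.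
have := modz_ge0 m k0'; have := ltz_mod m k0'.
case: (m %% k)%Z Hr => // [[|j]] // Hr ltjk _.
have := zmin j.+1 isT; rewrite pmulrn => /(_ Hr); lia.
Qed.

(** The image of [f] contains a nonzero multiple of [W], so it equals [kW] for some positive [k].
    Then [h] is multiplication by [k] followed by the inverse of [f]. *)
Lemma rank1_isomorphic (V W : zmodType) (f : V -> W) (g : W -> V) :
  torsion_free W -> locally_cyclic W ->
  injective f -> {morph f : x y / x + y} ->
  injective g -> {morph g : x y / x + y} ->
  exists h : W -> V, bijective h /\ {morph h : x y / x + y}.
Proof.
move=> tfW cycW injf fD injg gD.
have morph_z (U U' : zmodType) (h : U -> U') : {morph h : x y / x + y} ->
    forall x m, h (x *~ m) = h x *~ m.
  move=> hD x m; have h0 : h 0 = 0.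
    by apply: (addrI (h 0)); rewrite -hD !addr0.
  have hN y : h (- y) = - h y by apply: (addrI (h y)); rewrite -hD !subrr.
  have hn y k : h (y *+ k) = h y *+ k.
    by elim: k => [|k IHk]; rewrite ?mulr0n // !mulrS hD IHk.
  by case: m => m; rewrite -?pmulrn ?hn // NegzE !mulrNz hN -!pmulrn hn.
have fz := morph_z _ _ f fD; have gz := morph_z _ _ g gD.
have fN y : f (- y) = - f y by rewrite -mulrN1z fz mulrN1z.
have f0 : f 0 = 0 by rewrite -(mulr0z 0) fz mulr0z.
have g0 : g 0 = 0 by rewrite -(mulr0z 0) gz mulr0z.
pose H x := exists v, x = f v.
(* The map [f \o g] is multiplication by a rational [a/b], read off at one nonzero [x]. Hence
   [a y = f (b (g y))] for all [y], and [n] is the absolute value of [a]. *)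
have [n n0 Hn] : exists2 n : nat, (0 < n)%N & forall x, H (x *+ n).
  case: (pselect (exists x : W, x != 0)) => [[x x0]|triv]; last first.
    exists 1 => // x; exists 0; rewrite f0.
    by case: (eqVneq x 0) => [->|x0]; rewrite ?mul0rn //; case: triv; exists x.
  have fgx0 : f (g x) != 0.
    by apply: contra_neq x0 => fg0; apply/injg/injf; rewrite fg0 g0 f0.
  have [z [a [b [fgz xz]]]] := cycW (f (g x)) x.
  have a0 : a != 0 by apply: contra_neq fgx0 => a0; rewrite fgz a0 mulr0z.
  have b0 : b != 0 by apply: contra_neq x0 => b0; rewrite xz b0 mulr0z.
  have Ha y : H (y *~ a).
    have [t [c [d [yt zt]]]] := cycW y z.
    exists (g y *~ b).
    have fgt : f (g t) *~ b = t *~ a.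
      case: (eqVneq d 0) => [d0|d0].
        by case/eqP: x0; rewrite xz zt d0 mulr0z mul0rz.
      apply: (torsion_free_mulrzI tfW d0) => /=.
      by rewrite [RHS]mulrzAC -zt -fgz xz zt !gz !fz mulrzAC.
    by rewrite fz yt gz fz [RHS]mulrzAC fgt mulrzAC.
  exists (absz a) => [|y]; first by rewrite absz_gt0.
  rewrite pmulrn; case: (intP a) (Ha y) => [|k|k] // [v].
  by rewrite mulrNz => yv; exists (- v); rewrite fN -yv opprK.
have HB x y : H x -> H y -> H (x - y).
  by move=> [v ->] [w ->]; exists (v - w); rewrite fD fN.
have [k k0 HE] := bounded_subgroup cycW n0 HB Hn.
have inv (w : W) : exists v, f v = w *+ k.
  have /HE [v ->] : exists y, w *+ k = y *+ k by exists w.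
  by exists v.
have [h hE] := choice inv.
exists h; split; last first.
  by move=> x y; apply: injf; rewrite hE fD !hE mulrnDl.
have back v : exists w, f v = w *+ k by apply/HE; exists v.
have [h' h'E] := choice back.
have mulk : injective (fun w : W => w *+ k).
  move=> x y; rewrite !pmulrn; apply: torsion_free_mulrzI => //.
  by rewrite eqz_nat -lt0n.
exists h' => [w|v]; first by apply: mulk; rewrite -h'E hE.
by apply: injf; rewrite hE -h'E.
Qed.

End RankOne.

Lemma presents_group_morphism (A B : structure group_language)
    (V W : zmodType) (e : nat -> V) (d : nat -> W) (h : V -> W) j :
  presents_group A e -> presents_group B d ->
  {morph h : x y / (x + y)%R} -> (forall a, d (j a) = h (e a)) ->
  forall i args, symbol_of group_language i (size args) ->
    j (interp A i args) = interp B i (map j args).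
Proof.
move=> [_ eD eN e0] [[d' dK _] dD dN d0] hD jE.
have h0 : h 0%R = 0%R by apply: (addrI (h 0%R)); rewrite -hD !addr0.
have hN y : h (- y)%R = (- h y)%R.
  by apply: (addrI (h y)); rewrite -hD !subrr.
move=> [|[|[|i]]] [|a [|b [|c s]]] //= _; apply: (can_inj dK).
- by rewrite jE eD dD hD !jE.
- by rewrite jE eN dN hN !jE.
- by rewrite jE e0 d0 h0.
Qed.

Lemma TFAb1_biembedding (A B : structure group_language) f g :
  TFAb 1 A -> TFAb 1 B -> embedding A B f -> embedding B A g ->
  isomorphic A B.
Proof.
move=> [V [e [preA tfV rkV]]] [W [d [preB tfW rkW]]].
have [[e' eK e'K] eD eN e0] := preA; have [[d' dK d'K] dD dN d0] := preB.
move=> [injf homf] [injg homg].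
have [|||||h [bij_h hD]] :=
    @rank1_isomorphic W V (e \o g \o d') (d \o f \o e') tfV.
- exact: rank1_locally_cyclic.
- by apply: inj_comp; [apply: inj_comp injg; exact: can_inj eK|exact: can_inj d'K].
- move=> x y /=; rewrite -eD; congr e.
  rewrite -[[:: g _; _]]/(map g [:: d' x; d' y]) -homg //; congr g.
  by apply: (can_inj dK); rewrite dD !d'K.
- by apply: inj_comp; [apply: inj_comp injf; exact: can_inj dK|exact: can_inj e'K].
- move=> x y /=; rewrite -dD; congr d.
  rewrite -[[:: f _; _]]/(map f [:: e' x; e' y]) -homf //; congr f.
  by apply: (can_inj eK); rewrite eD !e'K.
exists (d' \o h \o e); split.
  by apply: bij_comp; [apply: bij_comp bij_h; exists d|exists e'].
by apply: (presents_group_morphism preA preB hD) => a /=; rewrite d'K.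
Qed.

(** * Enumerations *)

Section Enumeration.

Variables (T : eqType) (i s : nat -> T).
Hypotheses (inji : injective i) (surjs : forall x, exists n, s n = x).

(** An index is new when its value has not occurred before. Listing the new indices in order removes
    the repetitions from [s]. *)
Let new n := s n \notin map s (iota 0 n).

(** Otherwise every value occurs among the first [n], which is too few for the [n+1] distinct values
    of [i]. *)
Let new_unbounded n : exists m, (n <= m) && new m.
Proof.
apply: contrapT => nonew.
have sub x : x \in map s (iota 0 n).
  have [m0 sm0] := surjs x.
  have ex : exists m, s m == x by exists m0; apply/eqP.
  case: (ex_minnP ex) => m /eqP sm min_m.
  rewrite -sm map_f // mem_iota add0n ltnNge; apply/negP => lenm.
  apply: nonew; exists m; rewrite lenm /new; apply/mapP => -[m'].
  rewrite mem_iota /= add0n sm => ltm' xm'.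
  by have := min_m m'; rewrite xm' eqxx leqNgt ltm' => /(_ isT).
have := @uniq_leq_size _ (map i (iota 0 n.+1)) (map s (iota 0 n)).
rewrite map_inj_uniq // iota_uniq !size_map !size_iota ltnn.
by move/(_ isT (fun x _ => sub x)).
Qed.

Let next n := ex_minn (new_unbounded n).

Let nextP n : [/\ n <= next n, new (next n) &
  forall m, n <= m -> new m -> next n <= m].
Proof.
rewrite /next; case: ex_minnP => m /andP[lenm newm] min_m; split=> // k lek newk.
by apply: min_m; rewrite lek.
Qed.

Let pos := fix pos j := if j is j'.+1 then next (pos j').+1 else next 0.

Let pos_new j : new (pos j).
Proof. by case: j => [|j]; [case: (nextP 0)|case: (nextP (pos j).+1)]. Qed.

Let pos_mono j j' : j < j' -> pos j < pos j'.
Proof.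
apply: (homo_ltn ltn_trans) => k /=.
by case: (nextP (pos k).+1).
Qed.

Let pos_surj m : new m -> exists j, pos j = m.
Proof.
(* The invariant adds that the first new index from the bound on is itself listed, which lets the
   induction continue with [j.+1]. *)
suff [j [_ all_m]] : exists j, pos j = next m.+1 /\
    forall k, k < m.+1 -> new k -> exists j', pos j' = k by exact: all_m.
elim: m.+1 => [|n [j [posj IHn]]]; first by exists 0.
have [len newn min_n] := nextP n.
case newn': (new n).
  have nn : next n = n by apply/eqP; rewrite eqn_leq len min_n.
  exists j.+1; rewrite /= posj nn; split=> // k; rewrite ltnS leq_eqVlt.
  by case/predU1P=> [-> _|]; [exists j; rewrite posj|exact: IHn].
exists j; split.
  have [len1 newn1 min_n1] := nextP n.+1.
  rewrite posj; apply/eqP; rewrite eqn_leq min_n ?(ltnW len1) //= min_n1 //.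
  by rewrite ltn_neqAle len andbT; apply: contraTneq newn => <-; rewrite newn'.
move=> k; rewrite ltnS leq_eqVlt => /predU1P[->|]; last exact: IHn.
by rewrite newn'.
Qed.

Lemma enumeration_bijective : exists e : nat -> T, bijective e.
Proof.
exists (s \o pos).
have inje : injective (s \o pos).
  have main j j' : j < j' -> s (pos j) <> s (pos j').
    move=> /pos_mono ltp eqs; have := pos_new j'; rewrite /new -eqs map_f //.
    by rewrite mem_iota.
  move=> j j' /= eqs; case: (ltngtP j j') => // /main; last by rewrite eqs.
  by move/(_ eqs).
have surje x : exists j, s (pos j) = x.
  have ex : exists m, s m == x by have [m <-] := surjs x; exists m.
  case: (ex_minnP ex) => m /eqP sm min_m.
  have [|j posj] := @pos_surj m; last by exists j; rewrite posj.
  rewrite /new; apply/mapP => -[m'].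
  rewrite mem_iota /= add0n sm => ltm' xm'.
  by have := min_m m'; rewrite xm' eqxx leqNgt ltm' => /(_ isT).
have [g gK] := choice surje.
by exists g => // j; apply: inje; rewrite /= gK.
Qed.

End Enumeration.

(** The field is that of the classical reals. Their uncountability is available for bijections, so a
    surjection from [nat] is first turned into a bijection. *)
Lemma exists_uncountable_rcf :
  exists R : rcfType, forall s : nat -> R, exists x, forall n, s n <> x.
Proof.
exists Rdefinitions.R => s.
apply: contrapT => nex.
have surjs x : exists n, s n = x.
  by apply: contrapT => nx; apply: nex; exists x => n sn; apply: nx; exists n.
have inji : injective (fun n => n%:R%R : Rdefinitions.R).
  by move=> m n /eqP; rewrite eqr_nat => /eqP.
have [e [g eK gK]] := enumeration_bijective inji surjs.
by apply: (Runcountable.R_uncountable e); exists g.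
Qed.

Local Open Scope ring_scope.

(** * Algebraic elements *)

Definition subfield_pred (R : fieldType) (S : R -> Prop) :=
  [/\ S 1, forall x y, S x -> S y -> S (x - y),
      forall x y, S x -> S y -> S (x * y) & forall x, S x -> S x^-1].

Section SubfieldType.

Variables (R : fieldType) (S : R -> Prop).
Hypothesis subfieldS : subfield_pred S.

Let P : {pred R} := fun x => `[< S x >].

Let PP x : reflect (S x) (x \in P). Proof. exact: asboolP. Qed.

Let Pdivring : divring_closed P.
Proof.
have [S1 SB SM SV] := subfieldS.
split=> [|x y /PP Sx /PP Sy|x y /PP Sx /PP Sy]; apply/PP => //.
  exact: SB.
by apply: SM => //; apply: SV.
Qed.

HB.instance Definition _ := GRing.isDivringClosed.Build R P Pdivring.

Let T := {x : R | x \in P}.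
HB.instance Definition _ := SubType.on T.
HB.instance Definition _ := Choice.on T.
HB.instance Definition _ := [SubChoice_isSubIntegralDomain of T by <:].
HB.instance Definition _ := [SubIntegralDomain_isSubField of T by <:].

(** A field type in place of a predicate makes polynomials over the subfield available. *)
Lemma subfield_type : exists (F : fieldType) (iota : {rmorphism F -> R}),
  forall x, S x <-> exists a, iota a = x.
Proof.
exists T, (val : {rmorphism T -> R}) => x.
by split=> [/PP Sx|[[a /PP Sa] <-//]]; exists (Sub x Sx).
Qed.

End SubfieldType.

(** The coefficients lie in a ring, such as [{mpoly rat[n]}] with [f] an evaluation, so that
    algebraicity over a tuple is expressed without fractions. *)
Definition algebraic (D R : nzRingType) (f : D -> R) (y : R) :=
  exists2 q : {poly D}, q != 0 & root (map_poly f q) y.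

Section Fractions.

Variables (D : idomainType) (R : fieldType) (f : {rmorphism D -> R}).
Hypothesis injf : injective f.

Definition fraction_of (x : R) := exists p q, x = f p / f q.

Let fractionP x : fraction_of x -> exists p q, q != 0 /\ x = f p / f q.
Proof.
move=> [p [q ->]]; case: (eqVneq q 0) => [->|q0]; last by exists p, q.
by exists 0, 1; rewrite oner_neq0 !rmorph0 invr0 mulr0 mul0r.
Qed.

Let f_neq0 q : q != 0 -> f q != 0.
Proof. by apply: contra_neq => fq0; apply: injf; rewrite fq0 rmorph0. Qed.

Lemma subfield_fractions : subfield_pred fraction_of.
Proof.
split=> [|x y|x y|x [p [q ->]]].
- by exists 1, 1; rewrite rmorph1 divr1.
- move=> /fractionP[p [q [q0 ->]]] /fractionP[p' [q' [q'0 ->]]].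
  exists (p * q' - p' * q), (q * q').
  by rewrite rmorphB !rmorphM -[- (f p' / _)]mulNr addf_div ?f_neq0 // mulNr.
- move=> [p [q ->]] [p' [q' ->]]; exists (p * p'), (q * q').
  by rewrite !rmorphM mulf_div.
- by exists q, p; rewrite invf_div.
Qed.

Lemma fraction_of_base d : fraction_of (f d).
Proof. by exists d, 1; rewrite rmorph1 divr1. Qed.

Variables (K : fieldType) (k : {rmorphism K -> R}).
Hypothesis kP : forall x, fraction_of x <-> exists a, k a = x.

(** From left to right denominators are cleared, one coefficient at a time, with [c] as the common
    denominator. From right to left [l] lifts the coefficients from [D] to [K]. This gives access to
    the closure properties of algebraic elements over a field. *)
Lemma algebraic_fractions y : algebraic k y <-> algebraic f y.
Proof.
split=> [[p p0 py]|[q q0 qy]].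
  have [c [q [c0 qE]]] : exists c q, c != 0 /\
      map_poly f q = f c *: map_poly k p.
    elim/poly_ind: (p) => [|p' a [c [q [c0 qE]]]].
      by exists 1, 0; rewrite oner_neq0 !map_poly0 scaler0.
    have /fractionP[n [d [d0 ka]]] : fraction_of (k a) by apply/kP; exists a.
    exists (c * d), (d *: q * 'X + (c * n)%:P); split; first by rewrite mulf_neq0.
    rewrite !rmorphD /= ![map_poly _ (_ * 'X)]rmorphM /= !map_polyX !map_polyC /=.
    rewrite map_polyZ qE.
    rewrite scalerDr scalerA -rmorphM [d * c]mulrC -scalerAl; congr (_ + _).
    rewrite -mul_polyC -polyCM ka rmorphM -mulrA [f d * _]mulrCA mulfV ?f_neq0 //.
    by rewrite mulr1 rmorphM.
  exists q; last by rewrite qE rootZ ?f_neq0.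
  apply: contra_neq p0 => q0; apply/eqP; rewrite -(map_poly_eq0 k).
  have := qE; rewrite q0 map_poly0 => /esym/eqP.
  by rewrite scaler_eq0 (negPf (f_neq0 c0)).
have [l lE] := choice (fun d => (kP (f d)).1 (fraction_of_base d)).
exists (\poly_(i < size q) l q`_i).
  apply: contra_neq q0 => /polyP pq; apply/polyP => i.
  have := pq i; rewrite coef_poly !coef0; case: ltnP => [_ lq|leqi _].
    by apply: injf; rewrite -lE lq !rmorph0.
  by rewrite nth_default.
suff -> : map_poly k (\poly_(i < size q) l q`_i) = map_poly f q by [].
apply/polyP => i; rewrite coef_map coef_poly coef_map /=.
by case: ltnP => [_|leqi]; rewrite ?lE // [in RHS]nth_default // !rmorph0.
Qed.

End Fractions.

Section AlgebraicField.

Variables (K R : fieldType) (k : {rmorphism K -> R}).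

Lemma subfield_algebraic : subfield_pred (algebraic k).
Proof.
split; [exact: algebraic1 | exact: algebraic_sub | exact: algebraic_mul|].
exact: algebraic_inv.
Qed.

Lemma algebraic_sqrt y : algebraic k (y ^+ 2) -> algebraic k y.
Proof.
move=> [p p0 py]; exists (p \Po 'X^2).
  by rewrite comp_poly_eq0 ?size_polyXn.
by rewrite map_comp_poly map_polyXn /root horner_comp hornerXn.
Qed.

End AlgebraicField.

(** * Algebraic independence through polynomials in the last variable *)

Section Tuples.

Local Notation drop_last m := [multinom m (widen_ord (leqnSn _) i) | i < _].

Lemma mnmwiden_drop_last n (m : 'X_{1..n.+1}) :
  (mnmwiden (drop_last m) + U_(ord_max) *+ m ord_max)%MM = m.
Proof.
apply/mnmP => i; rewrite mnmDE mulmnE mnm1E.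
case: (unliftP ord_max i) => [j ->|->].
  have -> : lift ord_max j = widen_ord (leqnSn n) j.
    by apply: val_inj; rewrite /= /bump leqNgt ltn_ord.
  rewrite mnmwiden_widen mnmE -val_eqE /= gtn_eqF // mul0n addn0 //.
by rewrite mnmwiden_ordmax eqxx mul1n.
Qed.

(** This is the inverse of [muni]: the last variable is put back in place of the indeterminate. *)
Definition of_muni n (q : {poly {mpoly rat[n]}}) : {mpoly rat[n.+1]} :=
  (map_poly (@mwiden n _) q).['X_ord_max].

Lemma muniK n : cancel (@muni n rat) (@of_muni n).
Proof.
move=> p; rewrite muniE /of_muni rmorph_sum horner_sum [RHS]mpolyE.
apply: eq_bigr => m _.
rewrite -mul_polyC rmorphM /= map_polyC map_polyXn /= hornerM hornerC hornerXn.
rewrite mwidenZ mwidenX -scalerAl; congr (_ *: _).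
by rewrite mpolyXn -mpolyXD mnmwiden_drop_last.
Qed.

Lemma muni_mwiden n (c : {mpoly rat[n]}) : muni (mwiden c) = c%:P.
Proof.
elim/mpolyind: c => [|a m p _ _ IHp]; first by rewrite mwiden0 muni0.
rewrite mwidenD muniD IHp polyCD; congr (_ + _).
rewrite mwidenZ mwidenX muniZ muniE msuppX big_seq1 mcoeffX eqxx scale1r.
rewrite mnmwiden_ordmax expr0 alg_polyC -mul_mpolyC polyCM -mul_polyC.
by congr (_ * 'X_[_]%:P); apply/mnmP => i; rewrite mnmE mnmwiden_widen.
Qed.

Lemma of_muniK n : cancel (@of_muni n) (@muni n rat).
Proof.
move=> q; rewrite /of_muni -horner_map -map_poly_comp /=.
rewrite (eq_map_poly (fun c => muni_mwiden c)).
have -> : muni 'X_ord_max = 'X :> {poly {mpoly rat[n]}}.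
  rewrite muniE msuppX big_seq1 mcoeffX eqxx scale1r mnm1E eqxx expr1.
  suff -> : [multinom U_(ord_max)%MM (widen_ord (leqnSn n) i) | i < n] = 0%MM.
    by rewrite mpolyX0 scale1r.
  by apply/mnmP => i; rewrite mnmE mnm1E mnm0E -val_eqE /= gtn_eqF.
exact: comp_polyXr.
Qed.

Variable R : rcfType.

Definition eval_at n (x : n.-tuple R) : {mpoly rat[n]} -> R :=
  mmap (@ratr R) (tnth x).

HB.instance Definition _ n (x : n.-tuple R) :=
  GRing.RMorphism.on (eval_at x).

Lemma eval_at_X n (x : n.-tuple R) i : eval_at x 'X_i = tnth x i.
Proof. by rewrite /eval_at mmapX mmap1U. Qed.

Lemma eval_at_rcons n (x : n.-tuple R) y p :
  eval_at [tuple of rcons x y] p = (map_poly (eval_at x) (muni p)).[y].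
Proof.
rewrite muniE rmorph_sum horner_sum; apply: eq_bigr => m _.
rewrite -mul_polyC rmorphM /= map_polyC map_polyXn /= hornerM hornerC hornerXn.
rewrite /eval_at mmapZ mmapX -[RHS]mulrA; congr (ratr _ * _).
rewrite /mmap1 big_ord_recr /=; congr (_ * _ ^+ _).
  apply: eq_bigr => i _; rewrite mnmE; congr (_ ^+ _).
  by rewrite !(tnth_nth 0) /= nth_rcons size_tuple ltn_ord.
by rewrite (tnth_nth 0) /= nth_rcons size_tuple ltnn eqxx.
Qed.

Lemma alg_independentE n (x : n.-tuple R) :
  alg_independent x <-> injective (eval_at x).
Proof.
split=> [indx p q eqpq|injx p px0].
  apply/eqP; rewrite -subr_eq0; apply/eqP/indx.
  by have : eval_at x (p - q) = 0 by rewrite rmorphB /= eqpq subrr.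
by apply: injx; rewrite rmorph0.
Qed.

(** Through the bijection [muni], a relation between [x] and [y] is a nonzero polynomial in one
    variable over [{mpoly rat[n]}] that vanishes at [y]. *)
Lemma alg_independent_rcons n (x : n.-tuple R) y :
  alg_independent [tuple of rcons x y] <-> ~ algebraic (eval_at x) y.
Proof.
split=> [indxy [q q0 /rootP qy]|nalg p py0].
  case/eqP: q0; rewrite -[q]of_muniK.
  suff /indxy -> : eval_at [tuple of rcons x y] (of_muni q) = 0 by rewrite rmorph0.
  by rewrite eval_at_rcons of_muniK.
rewrite -[p]muniK; apply: contrapT => p0; apply: nalg.
exists (muni p); last by apply/rootP; rewrite -eval_at_rcons.
by apply/eqP => mp0; apply: p0; rewrite mp0 /of_muni rmorph0 horner0.
Qed.

Lemma rmorph_alg_independent (F : fieldType) (f : {rmorphism F -> R}) n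
    (x : n.-tuple F) :
  alg_independent x <-> alg_independent [tuple of map f x].
Proof.
have fE p : f (mmap ratr (tnth x) p) = eval_at [tuple of map f x] p.
  rewrite /eval_at /mmap rmorph_sum; apply: eq_bigr => m _.
  rewrite rmorphM; congr (_ * _).
    by rewrite /ratr fmorph_div !rmorph_int.
  rewrite /mmap1 rmorph_prod; apply: eq_bigr => i _.
  by rewrite rmorphXn tnth_map.
split=> indx p px0; apply: indx; last by rewrite -[RHS](rmorph0 f) -px0 fE.
by apply: (fmorph_inj f); rewrite fE rmorph0.
Qed.

End Tuples.

(** * Pythagorean closures *)

Lemma Zorn_family (T : Type) (P : (T -> Prop) -> Prop) :
  (forall F : (T -> Prop) -> Prop, (forall X, F X -> P X) ->
    (forall X Y, F X -> F Y ->
      (forall t, X t -> Y t) \/ (forall t, Y t -> X t)) ->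
    P (fun t => exists2 X, F X & X t)) ->
  exists A, P A /\
    forall B, P B -> (forall t, A t -> B t) -> forall t, B t -> A t.
Proof.
move=> chainP.
have [A [PA maxA]] := @classical_sets.Zorn_bigcup T P chainP.
exists A; split=> // B PB subAB t Bt; apply: contrapT => nAt.
by apply: (maxA B) PB; split=> // subBA; apply/nAt/subBA.
Qed.

(** The least subfield containing [G] and all the roots in [R] of [y^2 = 1 + x^2] with [x] already
    present; both signs of the root are included. *)
Inductive pyth_closure (R : fieldType) (G : R -> Prop) : R -> Prop :=
| pyth_gen x : G x -> pyth_closure G x
| pyth_1 : pyth_closure G 1
| pyth_B x y : pyth_closure G x -> pyth_closure G y -> pyth_closure G (x - y)
| pyth_M x y : pyth_closure G x -> pyth_closure G y -> pyth_closure G (x * y)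
| pyth_V x : pyth_closure G x -> pyth_closure G x^-1
| pyth_sqrt x y : pyth_closure G x -> y ^+ 2 = 1 + x ^+ 2 -> pyth_closure G y.

Lemma pyth_closure_subfield (R : fieldType) (G : R -> Prop) :
  subfield_pred (pyth_closure G).
Proof.
split; [exact: pyth_1 | exact: pyth_B | exact: pyth_M | exact: pyth_V].
Qed.

(* Partial homomorphisms are handled as graphs, i.e. sets of pairs. *)
Record hom_graph (R : fieldType) (S : R * R -> Prop) : Prop := HomGraph {
  graph_1 : S (1, 1);
  graph_B : forall x x' y y', S (x, x') -> S (y, y') -> S (x - y, x' - y');
  graph_M : forall x x' y y', S (x, x') -> S (y, y') -> S (x * y, x' * y');
  graph_V : forall x x', S (x, x') -> S (x^-1, x'^-1);
  graph_0 : forall y, S (0, y) -> y = 0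
}.

Section HomGraph.

Variables (R : fieldType) (S : R * R -> Prop).
Hypothesis homS : hom_graph S.

Lemma graph_00 : S (0, 0).
Proof.
by have := graph_B homS (graph_1 homS) (graph_1 homS); rewrite !subrr.
Qed.

Lemma graph_N x x' : S (x, x') -> S (- x, - x').
Proof. by rewrite -(sub0r x) -(sub0r x'); apply: graph_B graph_00. Qed.

Lemma graph_D x x' y y' : S (x, x') -> S (y, y') -> S (x + y, x' + y').
Proof.
by move=> Sx /graph_N Sy; rewrite -[y]opprK -[y']opprK; apply: graph_B.
Qed.

Lemma graph_fun x y y' : S (x, y) -> S (x, y') -> y = y'.
Proof.
move=> Sy Sy'; apply/eqP; rewrite -subr_eq0; apply/eqP/(graph_0 homS).
by rewrite -(subrr x); apply: graph_B.
Qed.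

Lemma graph_neq0 x x' : S (x, x') -> x != 0 -> x' != 0.
Proof.
move=> Sx; apply: contra_neq => x'0.
have := graph_M homS Sx (graph_V homS Sx); case: (eqVneq x 0) => // x0.
rewrite x'0 mul0r mulfV // => /(graph_fun (graph_1 homS)) /eqP.
by rewrite oner_eq0.
Qed.

(** As [z] is quadratic over the domain and outside it, the representation [u + v z] is unique, and
    [z] may go to any root of the transported equation. *)
Lemma hom_graph_sqrt x x' z z' : S (x, x') -> (forall y, ~ S (z, y)) ->
  z ^+ 2 = 1 + x ^+ 2 -> z' ^+ 2 = 1 + x' ^+ 2 ->
  hom_graph (fun p => exists u u' v v', [/\ S (u, u'), S (v, v') &
    p = (u + v * z, u' + v' * z')]).
Proof.
move=> Sx nSz zE z'E.
have S1x : S (1 + x ^+ 2, 1 + x' ^+ 2).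
  by rewrite !expr2; apply: graph_D; [exact: graph_1 | exact: graph_M].
have inner u u' v v' : S (u, u') -> S (v, v') -> u + v * z = 0 ->
    v = 0 /\ u' + v' * z' = 0.
  move=> Su Sv uvz0; have v0 : v = 0.
    apply: contrapT => /eqP v0; apply: (nSz (- u' * v'^-1)).
    have -> : z = - u * v^-1.
      by apply: (mulIf v0); rewrite mulfVK // mulrC; apply/eqP;
         rewrite -addr_eq0 addrC uvz0.
    by apply: graph_M => //; [exact: graph_N | exact: graph_V].
  split=> //; move: uvz0; rewrite v0 mul0r addr0 => u0.
  move: Su Sv; rewrite u0 v0 => /(graph_0 homS) -> /(graph_0 homS) ->.
  by rewrite mul0r addr0.
split.
- exists 1, 1, 0, 0; rewrite !mul0r !addr0.
  by split=> //; [exact: graph_1 | exact: graph_00].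
- move=> _ _ _ _ [u [u' [v [v' [Su Sv [-> ->]]]]]] [a [a' [b [b' [Sa Sb [-> ->]]]]]].
  exists (u - a), (u' - a'), (v - b), (v' - b'); split; try exact: graph_B.
  by congr (_, _); ring.
- move=> _ _ _ _ [u [u' [v [v' [Su Sv [-> ->]]]]]] [a [a' [b [b' [Sa Sb [-> ->]]]]]].
  exists (u * a + v * b * (1 + x ^+ 2)), (u' * a' + v' * b' * (1 + x' ^+ 2)),
    (u * b + v * a), (u' * b' + v' * a'); split.
  + by apply: graph_D; do ?apply: (graph_M homS).
  + by apply: graph_D; do ?apply: (graph_M homS).
  by congr (_, _); rewrite -?zE -?z'E; ring.
- move=> _ _ [u [u' [v [v' [Su Sv [-> ->]]]]]].
  case: (eqVneq (u + v * z) 0) => [uvz0|uvz0].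
    have [_ ->] := inner _ _ _ _ Su Sv uvz0; rewrite uvz0 invr0.
    exists 0, 0, 0, 0; rewrite !mul0r addr0.
    by split=> //; exact: graph_00.
  (* [d] is the norm of [u + v z]; the inverse is the conjugate [u - v z] divided by it. *)
  pose d := u ^+ 2 - v ^+ 2 * (1 + x ^+ 2).
  pose d' := u' ^+ 2 - v' ^+ 2 * (1 + x' ^+ 2).
  have Sd : S (d, d').
    rewrite /d /d' !(expr2 u) !(expr2 u') !(expr2 v) !(expr2 v').
    by apply: graph_B => //; do ?apply: (graph_M homS).
  have dE : d = (u + v * z) * (u - v * z) by rewrite /d -zE; ring.
  have d'E : d' = (u' + v' * z') * (u' - v' * z') by rewrite /d' -z'E; ring.
  have d0 : d != 0.
    rewrite dE mulf_neq0 //; apply: contra_neq uvz0 => umz0.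
    have [|v0 _] := inner u u' (- v) (- v') Su (graph_N Sv).
      by rewrite mulNr.
    move/eqP: v0; rewrite oppr_eq0 => /eqP v0.
    by move: umz0; rewrite v0 !mul0r subr0 addr0.
  have d'0 := graph_neq0 Sd d0.
  have w'0 : u' + v' * z' != 0.
    by apply: contra_neq d'0 => w'0; rewrite d'E w'0 mul0r.
  exists (u * d^-1), (u' * d'^-1), (- v * d^-1), (- v' * d'^-1).
  have Sd1 := graph_V homS Sd.
  split; [exact: graph_M| by apply: graph_M => //; exact: graph_N|].
  have invE (a b c : R) : a + b * c != 0 -> (a + b * c) * (a - b * c) != 0 ->
      (a + b * c)^-1 = a * ((a + b * c) * (a - b * c))^-1
        + - b * ((a + b * c) * (a - b * c))^-1 * c.
    move=> abc0; rewrite mulf_eq0 negb_or => /andP[_ abc0'].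
    by field; rewrite abc0 abc0'.
  by congr (_, _); rewrite ?dE ?d'E invE // -?dE -?d'E.
- move=> y [u [u' [v [v' [Su Sv [/esym uvz0 ->]]]]]].
  by have [_] := inner _ _ _ _ Su Sv uvz0.
Qed.

End HomGraph.

(** * Extension of partial homomorphisms to Pythagorean closures *)

Section Extension.

Variables (R : rcfType) (S0 : R * R -> Prop).
Hypothesis homS0 : hom_graph S0.

Lemma hom_graph_maximal : exists S, [/\ hom_graph S, (forall p, S0 p -> S p) &
  forall S', hom_graph S' -> (forall p, S p -> S' p) -> forall p, S' p -> S p].
Proof.
(* The union of the empty chain has to satisfy [P], hence the alternative of an empty set. *)
pose P S := (forall p, ~ S p) \/ (hom_graph S /\ forall p, S0 p -> S p).
have [F FP chainF|S [[S_0|[homS subS]] maxS]] := @Zorn_family _ P.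
- case: (pselect (exists2 X, F X & exists p, X p)) => [[X FX [p Xp]]|none]; last first.
    by left=> p [X FX Xp]; apply: none; exists X => //; exists p.
  right.
  have ne Y q : F Y -> Y q -> hom_graph Y /\ forall p, S0 p -> Y p.
    by move=> /FP [nY /nY|].
  have common q q' : (exists2 Y, F Y & Y q) -> (exists2 Y, F Y & Y q') ->
      exists Y, [/\ F Y, hom_graph Y, Y q & Y q'].
    move=> [Y FY Yq] [Y' FY' Yq'].
    have [homY _] := ne _ _ FY Yq; have [homY' _] := ne _ _ FY' Yq'.
    by case: (chainF _ _ FY FY') => sub; [exists Y'|exists Y]; split=> //; apply: sub.
  have [homX subX] := ne _ _ FX Xp.
  split; last by move=> q S0q; exists X => //; apply: subX.
  split.
  + by exists X => //; apply: graph_1.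
  + move=> x x' y y' Sx /(common _ _ Sx) [Y [FY homY Yx Yy]].
    by exists Y => //; apply: graph_B.
  + move=> x x' y y' Sx /(common _ _ Sx) [Y [FY homY Yx Yy]].
    by exists Y => //; apply: graph_M.
  + move=> x x' Sx; have [Y [FY homY Yx _]] := common _ _ Sx Sx.
    by exists Y => //; apply: graph_V.
  + move=> y Sy; have [Y [FY homY Yy _]] := common _ _ Sy Sy.
    exact: graph_0 Yy.
- case: (S_0 (1, 1)); apply: (maxS S0); last exact: graph_1.
    by right.
  by move=> p /S_0.
- exists S; split=> // S' homS' subS'; apply: (maxS S' _ subS').
  by right; split=> // p /subS /subS'.
Qed.

(** The domain of a maximal extension is closed under the square roots in question: a missing root
    [z] could be sent to a root of [1 + x'^2], which exists because [R] is real closed. *)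
Lemma pyth_closure_extension (G : R -> Prop) :
  (forall x, G x -> exists y, S0 (x, y)) ->
  exists S, [/\ hom_graph S, forall p, S0 p -> S p &
    forall x, pyth_closure G x -> exists y, S (x, y)].
Proof.
move=> GS0; have [S [homS subS maxS]] := hom_graph_maximal.
exists S; split=> // x; elim=> {x} [x /GS0[y S0y]||x y _ [x' Sx] _ [y' Sy]||x _ [x' Sx]|].
- by exists y; apply: subS.
- by exists 1; apply: graph_1.
- by exists (x' - y'); apply: graph_B.
- by move=> x y _ [x' Sx] _ [y' Sy]; exists (x' * y'); apply: graph_M.
- by exists x'^-1; apply: graph_V.
move=> x z _ [x' Sx] zE; apply: contrapT => noz.
have nSz y : ~ S (z, y) by move=> Sz; apply: noz; exists y.
have z'E : Num.sqrt (1 + x' ^+ 2) ^+ 2 = 1 + x' ^+ 2.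
  by rewrite sqr_sqrtr // addr_ge0 ?ler01 ?sqr_ge0.
apply: (nSz (Num.sqrt (1 + x' ^+ 2))).
apply: (maxS _ (hom_graph_sqrt homS Sx nSz zE z'E)).
  move=> [u u'] Su; exists u, u', 0, 0; rewrite !mul0r !addr0.
  by split=> //; exact: graph_00.
exists 0, 0, 1, 1; rewrite !mul1r !add0r.
by split=> //; [exact: graph_00 | exact: graph_1].
Qed.

End Extension.

(** Induction on the closure: the image of a root of [1 + x^2] is a root of [1 + x'^2], and the
    closure contains it whatever its sign. *)
Lemma hom_graph_pyth_closure (R : fieldType) (S : R * R -> Prop)
    (G G' : R -> Prop) : hom_graph S ->
  (forall x, pyth_closure G x -> exists y, S (x, y)) ->
  (forall x y, G x -> S (x, y) -> pyth_closure G' y) ->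
  forall x y, pyth_closure G x -> S (x, y) -> pyth_closure G' y.
Proof.
move=> homS domS GG' x y Gx; elim: Gx y => {x} [x Gx y||||x Gx IHx|].
- exact: GG'.
- by move=> y /(graph_fun homS (graph_1 homS)) <-; exact: pyth_1.
- move=> x y Gx IHx Gy IHy z.
  have [x' Sx] := domS _ Gx; have [y' Sy] := domS _ Gy.
  move=> /(graph_fun homS (graph_B homS Sx Sy)) <-.
  by apply: pyth_B; [exact: IHx|exact: IHy].
- move=> x y Gx IHx Gy IHy z.
  have [x' Sx] := domS _ Gx; have [y' Sy] := domS _ Gy.
  move=> /(graph_fun homS (graph_M homS Sx Sy)) <-.
  by apply: pyth_M; [exact: IHx|exact: IHy].
- move=> z; have [x' Sx] := domS _ Gx.
  by move=> /(graph_fun homS (graph_V homS Sx)) <-; apply/pyth_V/IHx.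
move=> x z Gx IHx zE z' Sz; have [x' Sx] := domS _ Gx.
apply: (pyth_sqrt (IHx _ Sx)); apply: (graph_fun homS (graph_M homS Sz Sz)).
rewrite -expr2 zE; apply: graph_D => //; first exact: graph_1.
exact: graph_M.
Qed.

(** The graph sends [p(t)/q(t)] to [p(t')/q(t')]; transcendence of [t] and [t'] keeps both
    denominators nonzero. *)
Lemma fraction_graph (K R : fieldType) (k : {rmorphism K -> R}) (t t' : R) :
  ~ algebraic k t -> ~ algebraic k t' ->
  exists S, [/\ hom_graph S, forall a, S (k a, k a) & S (t, t')].
Proof.
move=> nalgt nalgt'.
have [e [eM eB eC eX e_neq0]] : exists e : R -> {poly K} -> R,
    [/\ forall s p q, e s (p * q) = e s p * e s q,
        forall s p q, e s (p - q) = e s p - e s q,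
        forall s a, e s a%:P = k a, forall s, e s 'X = s &
        forall s q, ~ algebraic k s -> q != 0 -> e s q != 0].
  exists (fun s p => (map_poly k p).[s]).
  split=> [s p q|s p q|s a|s|s q nalg q0].
  - by rewrite rmorphM hornerM.
  - by rewrite rmorphB hornerD hornerN.
  - by rewrite map_polyC hornerC.
  - by rewrite map_polyX hornerX.
  - by apply/eqP => qs0; apply: nalg; exists q => //; apply/rootP.
have e0 s : e s 0 = 0 by rewrite -polyC0 eC rmorph0.
exists (fun xy => exists p q, [/\ q != 0, xy.1 = e t p / e t q & xy.2 = e t' p / e t' q]).
split; first split.
- by exists 1%:P, 1%:P; rewrite /= polyC_eq0 oner_neq0 !eC rmorph1 divr1.
- move=> _ _ _ _ [p [q [q0 /= -> ->]]] [p1 [q1 [q10 /= -> ->]]].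
  exists (p * q1 - p1 * q), (q * q1); rewrite /= mulf_neq0 // !eB !eM.
  by split=> //; field; rewrite !e_neq0.
- move=> _ _ _ _ [p [q [q0 /= -> ->]]] [p1 [q1 [q10 /= -> ->]]].
  by exists (p * p1), (q * q1); rewrite /= mulf_neq0 // !eM !mulf_div.
- move=> _ _ [p [q [q0 /= -> ->]]].
  (* For [p = 0] the swapped fraction [q/p] has denominator 0; the inverse, which is 0, is written
     as 0/1. *)
  case: (eqVneq p 0) => [->|p0]; last by exists q, p; rewrite /= !invf_div.
  exists 0, 1%:P; rewrite /= polyC_eq0 oner_neq0.
  by rewrite !e0 !mul0r invr0.
- move=> y [p [q [q0 /= /esym/eqP pq0 ->]]].
  move: pq0; rewrite mulf_eq0 invr_eq0 (negPf (e_neq0 _ _ nalgt q0)) orbF => /eqP pt0.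
  case: (eqVneq p 0) => [->|p0]; first by rewrite e0 mul0r.
  by have := e_neq0 _ _ nalgt p0; rewrite pt0 eqxx.
- by move=> a; exists a%:P, 1%:P; rewrite /= polyC_eq0 oner_neq0 !eC rmorph1 divr1.
- exists 'X, 1%:P; rewrite /= polyC_eq0 oner_neq0.
  by rewrite !eC !eX rmorph1 !divr1.
Qed.

(** * Bi-embeddable fields *)

Lemma roots_list (F : fieldType) (p : {poly F}) :
  exists rs : seq F, p != 0 -> forall y, root p y -> y \in rs.
Proof.
have [n] := ubnP (size p); elim: n p => // n IHn p ltpn.
case: (pselect (exists y, root p y)) => [[y /factor_theorem[q pE]]|noroot]; last first.
  by exists [::] => _ y py; case: noroot; exists y.
case: (eqVneq p 0) => [->|p0]; first by exists [::] => /eqP.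
have q0 : q != 0 by apply: contra_neq p0 => q0; rewrite pE q0 mul0r.
have [|rs qrs] := IHn q.
  by move: ltpn; rewrite pE size_Mmonic ?monicXsubC // size_XsubC addn2.
exists (y :: rs) => _ z; rewrite pE rootM root_XsubC inE => /orP[/(qrs q0) ->|->//].
by rewrite orbT.
Qed.

(** * Independent tuples in an uncountable real closed field *)

Section Uncountable.

Variable R : rcfType.
Hypothesis uncountableR : forall s : nat -> R, exists x, forall n, s n <> x.

Definition mpoly_of_seq n (l : seq (rat * 'X_{1..n})) : {mpoly rat[n]} :=
  \sum_(c <- l) c.1 *: 'X_[c.2].

(** An algebraic element is coded by a polynomial that it annuls and its index in the list of roots;
    the polynomial is coded by lists of coefficients and monomials. *)
Lemma algebraic_enumerable n (x : n.-tuple R) : alg_independent x ->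
  exists s : nat -> R, forall y, algebraic (eval_at x) y -> exists m, s m = y.
Proof.
move=> /alg_independentE injx; have [rs rsP] := choice (@roots_list R).
pose poly_of (c : seq (seq (rat * 'X_{1..n}))) :=
  map_poly (eval_at x) (Poly (map (@mpoly_of_seq n) c)).
pose code : Type := (seq (seq (rat * 'X_{1..n})) * nat)%type.
exists (fun m => if (unpickle m : option code) is Some (c, k)
  then nth 0 (rs (poly_of c)) k else 0) => y [q q0 qy].
have [l lE] : exists l : {mpoly rat[n]} -> seq (rat * 'X_{1..n}),
    forall p, mpoly_of_seq (l p) = p.
  exists (fun p => [seq (p@_m, m) | m <- msupp p]) => p.
  by rewrite /mpoly_of_seq big_map /= -mpolyE.
have cE : Poly (map (@mpoly_of_seq n) (map l q)) = q.
  by rewrite -map_comp (eq_map (g := id)) ?map_id ?polyseqK.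
have /rsP/(_ y qy) yrs : map_poly (eval_at x) q != 0.
  apply: contra_neq q0 => q_0; apply: (map_inj_poly injx (rmorph0 _)).
  by rewrite q_0 map_poly0.
exists (pickle ((map l q, index y (rs (map_poly (eval_at x) q))) : code)).
by rewrite pickleK /poly_of cE nth_index.
Qed.

Lemma extend_independent n (x : n.-tuple R) : alg_independent x ->
  exists y, alg_independent [tuple of rcons x y].
Proof.
move=> indx; have [s sP] := algebraic_enumerable indx.
have [y ny] := uncountableR s; exists y; apply/alg_independent_rcons.
by move=> /sP[m]; apply: ny.
Qed.

Lemma exists_independent n : exists x : n.-tuple R, alg_independent x.
Proof.
elim: n => [|n [x /extend_independent[y indy]]]; last by exists [tuple of rcons x y].
exists [tuple]; apply/alg_independentE => p q; rewrite (nvar0_mpolyC p) (nvar0_mpolyC q).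
by rewrite /eval_at !mmapC => /fmorph_inj ->.
Qed.

End Uncountable.

Definition identity_graph (R : Type) (p : R * R) := p.1 = p.2.

Lemma hom_graph_identity (R : fieldType) : hom_graph (@identity_graph R).
Proof.
by split; rewrite /identity_graph /=; do ?[move=> > -> // -> //|move=> > -> //].
Qed.

Lemma pyth_closure_sub (R : fieldType) (G G' : R -> Prop) :
  (forall x, G x -> pyth_closure G' x) ->
  forall x, pyth_closure G x -> pyth_closure G' x.
Proof.
move=> GG' x; elim=> {x} //.
- exact: pyth_1.
- by move=> x y _ ? _ ?; exact: pyth_B.
- by move=> x y _ ? _ ?; exact: pyth_M.
- by move=> x _ ?; exact: pyth_V.
- by move=> x y _ G'x; exact: pyth_sqrt.
Qed.

Section SubfieldTheory.

Variables (R : fieldType) (S : R -> Prop).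
Hypothesis subS : subfield_pred S.

Lemma subfield0 : S 0.
Proof. by case: subS => S1 SB _ _; rewrite -(subrr 1); apply: SB. Qed.

Lemma subfieldN x : S x -> S (- x).
Proof. by case: subS => _ SB _ _ Sx; rewrite -sub0r; apply: SB => //; apply: subfield0. Qed.

Lemma subfieldD x y : S x -> S y -> S (x + y).
Proof.
by case: (subS) => _ SB _ _ Sx Sy; rewrite -[y]opprK; apply/SB/subfieldN.
Qed.

End SubfieldTheory.

(* As [presents_field], with [e] composed with the inclusion of [S] in [R]. *)
Record presents_subfield (R : fieldType) (S : R -> Prop)
    (A : structure field_language) (e : nat -> R) : Prop := PresentsSubfield {
  presents_inj : injective e;
  presents_range : forall z, S z <-> exists a, e a = z;
  presents_D : forall a b, e (interp A 0 [:: a; b]) = e a + e b;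
  presents_M : forall a b, e (interp A 1 [:: a; b]) = e a * e b;
  presents_N : forall a, e (interp A 2 [:: a]) = - e a;
  presents_0 : e (interp A 3 [::]) = 0;
  presents_1 : e (interp A 4 [::]) = 1
}.

(** The bijection of [S] with [nat] comes from the enumeration [s] and from the infinitely many
    natural numbers in [S]. The second part lets the transcendence degree be checked inside [R]. *)
Lemma subfield_structure (R : rcfType) (S : R -> Prop) :
  subfield_pred S -> (exists s : nat -> R, forall z, S z -> exists m, s m = z) ->
  exists A e, presents_subfield S A e /\
    forall r (x : r.-tuple R), (forall z, z \in x -> S z) -> alg_independent x ->
      (forall y, S y -> ~ alg_independent [tuple of rcons x y]) -> FD r A.
Proof.
move=> subS [s sP]; have [F [f fP]] := subfield_type subS.
have f_inj : injective f := fmorph_inj f.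
(* [l] inverts the inclusion [f] on [S], with value 0 elsewhere. *)
have /choice[l lE] : forall z, exists a, S z -> f a = z.
  move=> z; case: (pselect (S z)) => [/fP[a fa]|nSz]; first by exists a.
  by exists 0.
have [e bij_e] : exists e : nat -> F, bijective e.
  apply: (@enumeration_bijective _ (fun m => m%:R) (l \o s)) => [m m' eqm|a].
    by apply/eqP; rewrite -(eqr_nat R) -!(rmorph_nat f) eqm.
  have [m sm] := sP _ ((fP (f a)).2 (ex_intro _ a erefl)).
  exists m; apply: f_inj; rewrite /= lE ?sm //.
  by apply/fP; exists a.
have [g eK gK] := bij_e.
pose op (i : nat) (args : seq nat) := match i, args with
  | 0%N, [:: a; b] => g (e a + e b)
  | 1%N, [:: a; b] => g (e a * e b)
  | 2%N, [:: a] => g (- e a)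
  | 3%N, _ => g 0
  | _, _ => g 1
  end.
exists (Structure field_language op), (f \o e); split.
  split=> [|z|a b|a b|a||] /=; rewrite ?gK ?rmorphD ?rmorphM ?rmorphN ?rmorph0 ?rmorph1 //.
    by apply: inj_comp => //; apply: can_inj eK.
  by rewrite fP; split=> [[a <-]|[a <-]]; [exists (g a); rewrite gK|exists (e a)].
move=> r x xS indx depx; exists F, e; split.
- by split=> //= *; rewrite gK.
- by move=> p; rewrite -(fmorph_pchar f) pchar_num.
have mapx : [tuple of map f [tuple of map l x]] = x.
  apply: val_inj; rewrite /= -map_comp map_id_in // => z zx /=.
  by rewrite lE //; apply: xS.
exists [tuple of map l x]; split=> [|y].
  by rewrite (rmorph_alg_independent f) mapx.
have Sfy : S (f y) by apply/fP; exists y.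
rewrite (rmorph_alg_independent f) => indxy; apply: (depx _ Sfy).
suff <- : [tuple of map f [tuple of rcons [tuple of map l x] y]] =
  [tuple of rcons x (f y)] by [].
by apply: val_inj; rewrite /= map_rcons -[in RHS]mapx.
Qed.

Lemma graph_embedding (R : fieldType) (T S1 S2 : _) A1 A2 (e1 e2 : nat -> R) :
  presents_subfield S1 A1 e1 -> presents_subfield S2 A2 e2 -> hom_graph T ->
  (forall z, S1 z -> exists2 y, S2 y & T (z, y)) ->
  exists j, embedding A1 A2 j.
Proof.
move=> pre1 pre2 homT T12.
have : forall a, exists b, T (e1 a, e2 b).
  move=> a; have [|y /(presents_range pre2)[b <-] Tb] := T12 (e1 a).
    by apply/(presents_range pre1); exists a.
  by exists b.
move=> /choice[j jT]; exists j; split=> [a b eqj|i args].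
  apply/(presents_inj pre1)/eqP; rewrite -subr_eq0.
  have := graph_B homT (jT a) (jT b); rewrite eqj subrr => T0.
  apply: contraT => /(graph_neq0 homT T0); by rewrite eqxx.
have funT := graph_fun homT.
move=> Li; apply: (presents_inj pre2).
apply: (funT _ _ _ (jT _)).
case: i args Li => [|[|[|[|[|i]]]]] [|a [|b [|c args]]] //= _.
- by rewrite (presents_D pre1) (presents_D pre2); apply: graph_D.
- by rewrite (presents_M pre1) (presents_M pre2); apply: graph_M.
- by rewrite (presents_N pre1) (presents_N pre2); apply: graph_N.
- by rewrite (presents_0 pre1) (presents_0 pre2); apply: graph_00.
- by rewrite (presents_1 pre1) (presents_1 pre2); apply: graph_1.
Qed.

Lemma FD_copy r A f g : cancel f g -> cancel g f -> FD r A -> FD r (copy A f g).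
Proof.
move=> fK gK [F [e [[bij_e eD eM eN [e0 e1]] charF degF]]].
exists F, (e \o f); split=> //.
split=> [|x y|x y|x|] /=; rewrite ?gK //.
  by apply: bij_comp => //; exists g.
Qed.

(** Trees, of which there are countably many, code the derivations of membership in the Pythagorean
    closure. The labels 4 and 5 give the two signs of the root. *)
Fixpoint pyth_eval (R : rcfType) (g : seq R) (t : GenTree.tree nat) : R :=
  match t with
  | GenTree.Leaf i => nth 0 g i
  | GenTree.Node 1 [:: a; b] => pyth_eval g a - pyth_eval g b
  | GenTree.Node 2 [:: a; b] => pyth_eval g a * pyth_eval g b
  | GenTree.Node 3 [:: a] => (pyth_eval g a)^-1
  | GenTree.Node 4 [:: a] => Num.sqrt (1 + pyth_eval g a ^+ 2)
  | GenTree.Node 5 [:: a] => - Num.sqrt (1 + pyth_eval g a ^+ 2)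
  | GenTree.Node _ _ => 1
  end.

Lemma pyth_closure_enumerable (R : rcfType) (g : seq R) :
  exists s : nat -> R, forall z, pyth_closure (fun x => x \in g) z ->
    exists m, s m = z.
Proof.
exists (fun m => if unpickle m is Some t then pyth_eval g t else 0) => z gz.
suff [t <-] : exists t, pyth_eval g t = z by exists (pickle t); rewrite pickleK.
elim: gz => {z} [x xg||x y _ [a <-] _ [b <-]|x y _ [a <-] _ [b <-]|x _ [a <-]|].
- by exists (GenTree.Leaf (index x g)); rewrite /= nth_index.
- by exists (GenTree.Node 0 [::]).
- by exists (GenTree.Node 1 [:: a; b]).
- by exists (GenTree.Node 2 [:: a; b]).
- by exists (GenTree.Node 3 [:: a]).
move=> x y _ [a <-] yE; have := sqrtr_sqr y; rewrite yE => sqrtE.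
case: (ger0P y) sqrtE => _ sqrtE; first by exists (GenTree.Node 4 [:: a]).
by exists (GenTree.Node 5 [:: a]); rewrite /= sqrtE opprK.
Qed.

(** * The fields [P t] and [P t (w)] *)

Section Fields.

Variables (R : rcfType) (n : nat) (x0 : n.-tuple R) (w : R).
Hypotheses (ind0 : alg_independent x0)
  (indw : alg_independent [tuple of rcons x0 w]).

Let P s := pyth_closure (fun z => z \in rcons x0 s).
Let t := w ^+ 2.

Let alg0 := algebraic (eval_at x0).

Let alg0_field : subfield_pred alg0 /\ forall z, alg0 (z ^+ 2) -> alg0 z.
Proof.
have injx := (alg_independentE x0).1 ind0.
have [K [k kP]] := subfield_type (subfield_fractions injx).
have kE := algebraic_fractions injx kP.
split=> [|z /kE/algebraic_sqrt/kE //].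
have [A1 AB AM AV] := subfield_algebraic k.
split; rewrite /alg0.
- exact/kE.
- by move=> x y /kE Ax /kE Ay; apply/kE/AB.
- by move=> x y /kE Ax /kE Ay; apply/kE/AM.
- by move=> x /kE Ax; apply/kE/AV.
Qed.

Let nalg_w : ~ alg0 w.
Proof. exact/alg_independent_rcons. Qed.

Let nalg_t : ~ alg0 t.
Proof. by move/alg0_field.2. Qed.

Let ind_t : alg_independent [tuple of rcons x0 t].
Proof. exact/alg_independent_rcons. Qed.

(** Both elements are transcendental over the field generated by [x0], so [s] may be sent to [s'];
    the map then extends to the closure. It may violate the order of [R], which is what makes it
    useful for showing that elements are not squares. *)
Lemma pyth_closure_hom s s' : ~ alg0 s -> ~ alg0 s' ->
  exists T, [/\ hom_graph T, T (s, s') &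
    forall z, P s z -> exists2 y, P s' y & T (z, y)].
Proof.
have injx := (alg_independentE x0).1 ind0.
have [K [k kP]] := subfield_type (subfield_fractions injx).
have kE := algebraic_fractions injx kP.
move=> nalgs nalgs'.
have [||T0 [homT0 T0k T0s]] := @fraction_graph _ _ k s s'; [exact/kE|exact/kE|].
have x0k z : z \in (x0 : seq R) -> exists a, k a = z.
  move=> /tnthP[i ->]; apply/kP; exists 'X_i, 1.
  by rewrite rmorph1 divr1 /= eval_at_X.
have [|T [homT subT domT]] := @pyth_closure_extension _ _ homT0 (fun z => z \in rcons x0 s).
  move=> z; rewrite mem_rcons inE => /predU1P[->|/x0k[a <-]]; first by exists s'.
  by exists (k a).
exists T; split=> // [|z Pz]; first exact: subT.
have [y Ty] := domT z Pz; exists y => //.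
apply: (hom_graph_pyth_closure homT domT _ Pz Ty) => {Pz Ty} {}z {}y.
rewrite mem_rcons inE => /predU1P[->|zx0] Ty.
  have -> := graph_fun homT Ty (subT _ T0s).
  by apply: pyth_gen; rewrite mem_rcons mem_head.
have [a kaz] := x0k z zx0; move: Ty; rewrite -kaz.
move=> /(graph_fun homT (subT _ (T0k a))) <-; rewrite kaz.
by apply: pyth_gen; rewrite mem_rcons inE zx0 orbT.
Qed.

Let Pt := P t.
Let subP := pyth_closure_subfield (fun z => z \in rcons x0 t).
Let Pt_t : Pt t. Proof. by apply: pyth_gen; rewrite mem_rcons mem_head. Qed.
Let Pt_1 : Pt 1. Proof. exact: pyth_1. Qed.

(** Sending [t] to [s] turns [1 + t] into [-1 - t^2], which is negative. *)
Let nonsquare_1t z : Pt z -> z ^+ 2 <> 1 + t.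
Proof.
move=> Pz zE; pose s := - 2 - t ^+ 2.
have [A1 AB AM AV] := alg0_field.1.
have nalg_s : ~ alg0 s.
  move=> As; apply/nalg_t/alg0_field.2.
  have -> : t ^+ 2 = (1 - 1 - 1 - 1) - s by rewrite /s; ring.
  by do !(apply: (AB) => //).
have [T [homT Tts domT]] := pyth_closure_hom nalg_t nalg_s.
have [y _ Tzy] := domT z Pz.
have yE : y * y = 1 + s.
  apply: (graph_fun homT (graph_M homT Tzy Tzy)).
  by rewrite -expr2 zE; apply: graph_D => //; apply: graph_1.
by have := sqr_ge0 y; have := sqr_ge0 t; rewrite [y ^+ 2]expr2 yE /s; lra.
Qed.

(** Sending [t] to [s] turns [t (1 + t)] into minus the square of [t / (1 + t^2)], which is negative
    as [t] is nonzero. *)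
Let nonsquare_tt z : Pt z -> z ^+ 2 <> t * (1 + t).
Proof.
move=> Pz zE; pose s := - (1 + t ^+ 2)^-1.
have [A1 AB AM AV] := alg0_field.1.
have t2 : 0 < 1 + t ^+ 2 by have := sqr_ge0 t; lra.
have nalg_s : ~ alg0 s.
  move=> As; apply/nalg_t/alg0_field.2.
  have -> : t ^+ 2 = (1 - 1 - 1) - s^-1 by rewrite /s invrN invrK; ring.
  by apply: (AB); [do !apply: (AB)|exact: AV].
have [T [homT Tts domT]] := pyth_closure_hom nalg_t nalg_s.
have [y _ Tzy] := domT z Pz.
have yE : y * y = s * (1 + s).
  apply: (graph_fun homT (graph_M homT Tzy Tzy)).
  rewrite -expr2 zE; apply: graph_M => //; apply: graph_D => //.
  exact: graph_1.
have sE : s * (1 + s) = - (t / (1 + t ^+ 2)) ^+ 2.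
  by rewrite /s; field; rewrite gt_eqF.
have t0 : t != 0.
  apply/eqP => t0; apply: nalg_t; rewrite t0.
  by rewrite -(subrr 1); apply: (AB).
have : 0 < (t / (1 + t ^+ 2)) ^+ 2.
  by rewrite exprn_even_gt0 //= mulf_neq0 // invr_eq0 gt_eqF.
by have := sqr_ge0 y; rewrite [y ^+ 2]expr2 yE sE; lra.
Qed.

(** With [w] the field [Pt] would contain a root of [1 + w^2 = 1 + t]. *)
Let w_notin : ~ Pt w.
Proof.
move=> Pw; have Pz : Pt (Num.sqrt (1 + w ^+ 2)).
  apply: (pyth_sqrt Pw); rewrite sqr_sqrtr // addr_ge0 ?ler01 ?sqr_ge0 //.
by apply: (nonsquare_1t Pz); rewrite sqr_sqrtr // addr_ge0 ?ler01 ?sqr_ge0.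
Qed.

(** The quadratic extension of [Pt] by [w], a root of [t]. *)
Let Q z := exists u v, [/\ Pt u, Pt v & z = u + v * w].

Let Pt_Q z : Pt z -> Q z.
Proof.
by move=> Pz; exists z, 0; rewrite mul0r addr0; split=> //; apply: subfield0.
Qed.

Let Qw : Q w.
Proof.
by exists 0, 1; rewrite mul1r add0r; split=> //; apply: subfield0.
Qed.

(** Linear independence of [1] and [w] over [Pt]. *)
Let Q_nonzero u v : Pt u -> Pt v -> u + v * w = 0 -> u = 0 /\ v = 0.
Proof.
move=> Pu Pv uv0; have v0 : v = 0.
  apply: contrapT => /eqP v0; apply: w_notin.
  have -> : w = - (u / v).
    apply: (mulfI v0); rewrite mulrN mulrCA mulfV // mulr1; apply/eqP.
    by rewrite -addr_eq0 addrC uv0.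
  by apply: subfieldN => //; apply: pyth_M => //; apply: pyth_V.
by move: uv0; rewrite v0 mul0r addr0.
Qed.

Let subfieldQ : subfield_pred Q.
Proof.
split=> [|_ _ [u [v [Pu Pv ->]]] [u' [v' [Pu' Pv' ->]]]
         |_ _ [u [v [Pu Pv ->]]] [u' [v' [Pu' Pv' ->]]]|_ [u [v [Pu Pv ->]]]].
- exact: Pt_Q.
- exists (u - u'), (v - v'); split; [exact: pyth_B|exact: pyth_B|ring].
- exists (u * u' + v * v' * t), (u * v' + v * u'); split; last by rewrite /t; ring.
    by apply: subfieldD => //; [exact: pyth_M|apply: pyth_M => //; exact: pyth_M].
  by apply: subfieldD => //; exact: pyth_M.
case: (eqVneq (u + v * w) 0) => [->|uv0].
  by rewrite invr0; apply: Pt_Q; apply: subfield0.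
have umv0 : u - v * w != 0.
  apply: contra_neq uv0; rewrite -mulNr.
  move=> /(Q_nonzero Pu (subfieldN subP Pv))[-> /eqP].
  by rewrite oppr_eq0 => /eqP ->; rewrite mul0r addr0.
have uvE : u ^+ 2 - v ^+ 2 * t = (u + v * w) * (u - v * w) by rewrite /t; ring.
exists (u / (u ^+ 2 - v ^+ 2 * t)), (- v / (u ^+ 2 - v ^+ 2 * t)).
have Pd : Pt (u ^+ 2 - v ^+ 2 * t)^-1.
  by apply: pyth_V; rewrite !expr2; apply: pyth_B; [exact: pyth_M|apply: pyth_M => //; exact: pyth_M].
split; [exact: pyth_M|by apply: pyth_M => //; exact: subfieldN|].
by rewrite uvE; field; rewrite uv0 umv0.
Qed.

Let Q_P z : Q z -> P w z.
Proof.
have Pw : P w w by apply: pyth_gen; rewrite mem_rcons mem_head.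
have PtP y : Pt y -> P w y.
  apply: pyth_closure_sub => {}y; rewrite mem_rcons inE => /predU1P[->|yx0].
    by rewrite /t expr2; apply: pyth_M.
  by apply: pyth_gen; rewrite mem_rcons inE yx0 orbT.
move=> [u [v [/PtP Pu /PtP Pv ->]]].
by apply: (subfieldD (pyth_closure_subfield _)) => //; apply: pyth_M.
Qed.

(** Comparing the coefficients of [1] and [w] in [(u + v w)^2 = 1 + t] gives [u v = 0]. If [u = 0],
    then [(v t)^2 = t (1 + t)]; if [v = 0], then [u^2 = 1 + t]. *)
Let nonsquare_Q z : Q z -> z ^+ 2 <> 1 + w ^+ 2.
Proof.
move=> [u [v [Pu Pv ->]]] zE; have : u ^+ 2 + v ^+ 2 * t - (1 + t) + 2 * (u * v) * w = 0.
  by have -> : 1 + t = (u + v * w) ^+ 2; [rewrite zE|rewrite /t; ring].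
have P2 : Pt 2 by apply: (subfieldD subP).
move=> /Q_nonzero[||uvE /eqP].
- apply: pyth_B; last exact: subfieldD.
  by apply: subfieldD => //; [rewrite expr2|rewrite expr2]; do !(apply: pyth_M => //).
- by do !(apply: pyth_M => //).
rewrite mulf_eq0 pnatr_eq0 /= mulf_eq0 => /orP[/eqP u0|/eqP v0].
  apply: (@nonsquare_tt (v * t)); first exact: pyth_M.
  move: uvE; rewrite u0 expr0n /= add0r => /eqP; rewrite subr_eq0 => /eqP <-.
  by ring.
apply: (nonsquare_1t Pu); move: uvE; rewrite v0 expr0n /= mul0r addr0.
by move/eqP; rewrite subr_eq0 => /eqP.
Qed.

(** The element [w] is a root of [t], and the closure adds only square roots, so all of [P w] is
    algebraic over [x0] and [t]. Thus [Pt] and [Q] share the transcendence basis [rcons x0 t]. *)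
Let P_algebraic y : P w y ->
  ~ alg_independent [tuple of rcons [tuple of rcons x0 t] y].
Proof.
set x1 := [tuple of rcons x0 t].
have injx := (alg_independentE x1).1 ind_t.
have [K [k kP]] := subfield_type (subfield_fractions injx).
move=> Py /alg_independent_rcons; apply.
apply/(algebraic_fractions injx kP).
have [A1 AB AM AV] := subfield_algebraic k.
have A_x1 z : z \in (x1 : seq R) -> algebraic k z.
  move=> /tnthP[i ->]; have [a <-] : exists a, k a = tnth x1 i.
    by apply/kP; exists 'X_i, 1; rewrite rmorph1 divr1 /= eval_at_X.
  exact: algebraic_id.
elim: Py => {y} //.
- move=> y; rewrite mem_rcons inE => /predU1P[->|yx0].
    by apply/algebraic_sqrt/A_x1; rewrite mem_rcons mem_head.
  by apply: A_x1; rewrite mem_rcons inE yx0 orbT.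
- by move=> y z _ Ay _ Az; apply: AB.
- by move=> y z _ Ay _ Az; apply: AM.
- by move=> y _; apply: AV.
move=> y z _ Ay zE; apply: algebraic_sqrt.
by rewrite zE expr2; apply: (subfieldD (subfield_algebraic k)) => //; apply: AM.
Qed.

Lemma biembeddable_FD : exists A A' j j',
  [/\ FD n.+1 A /\ FD n.+1 A', embedding A A' j, embedding A' A j'
    & ~ isomorphic A A'].
Proof.
have [s sP] := pyth_closure_enumerable (rcons x0 t).
have [s' s'P] := pyth_closure_enumerable (rcons x0 w).
have [A [e [preA FDA]]] := subfield_structure subP (ex_intro _ s sP).
have [A' [e' [preA' FDA']]] :=
  subfield_structure subfieldQ (ex_intro _ s' (fun z Qz => s'P z (Q_P Qz))).
have [j Aj] : exists j, embedding A A' j.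
  apply: (graph_embedding preA preA' (hom_graph_identity R)) => z Pz.
  by exists z; first exact: Pt_Q.
have [T [homT _ domT]] := pyth_closure_hom nalg_w nalg_t.
have [j' Aj'] : exists j, embedding A' A j.
  apply: (graph_embedding preA' preA homT) => z /Q_P Pz; exact: domT.
exists A, A', j, j'; split=> //.
  have Pt_gen z : z \in [tuple of rcons x0 t] -> Pt z by move=> zx; apply: pyth_gen.
  split.
    apply: (FDA _ [tuple of rcons x0 t]) => // y Py.
    exact/P_algebraic/Q_P/Pt_Q.
  apply: (FDA' _ [tuple of rcons x0 t]) => [z /Pt_gen||y /Q_P] //.
    exact: Pt_Q.
  exact: P_algebraic.
move=> [f [[g fK gK] homf]].
have [a' a'w] := (presents_range preA' w).1 Qw.
(* In [Pt] one plus the square of the preimage [g a'] of [w] has a root, named [b]. Its image under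
   the isomorphism would be a root of [1 + w^2] in [Q]. *)
have [b bE] : exists b,
    interp A 0 [:: interp A 4 [::]; interp A 1 [:: g a'; g a']] =
    interp A 1 [:: b; b].
  have Pa : Pt (e (g a')) by apply/(presents_range preA); exists (g a').
  pose z := Num.sqrt (1 + e (g a') ^+ 2).
  have zE : z ^+ 2 = 1 + e (g a') ^+ 2.
    by rewrite sqr_sqrtr // addr_ge0 ?ler01 ?sqr_ge0.
  have [b bz] := (presents_range preA z).1 (pyth_sqrt Pa zE).
  exists b; apply: (presents_inj preA).
  rewrite (presents_D preA) !(presents_M preA) (presents_1 preA).
  by rewrite bz -!expr2 zE.
apply: (@nonsquare_Q (e' (f b))).
  by apply/(presents_range preA'); exists (f b).
have := congr1 (e' \o f) bE; rewrite /= !homf //= !homf //= gK.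
rewrite (presents_D preA') !(presents_M preA') (presents_1 preA') a'w.
by rewrite -!expr2.
Qed.

End Fields.

Local Close Scope ring_scope.

(** * Contradiction from two bi-embeddable fields *)

Theorem theorem6p7 (r : nat) (hr : 0 < r) :
  ~ exists Phi Phis : oracle_machine,
      turing_computable_embedding (FD r) (TFAb 1) Phi /\
      computable_functor (FD r) (TFAb 1) Phi Phis.
Proof.
case: r hr => // n _ [Phi [Phis [[opPhi embPhi] functor]]].
have [R uncR] := exists_uncountable_rcf.
have [x0 ind0] := exists_independent uncR n.
have [w indw] := extend_independent uncR ind0.
have [A [A' [j [j' [[FDA FDA'] Aj A'j nisoA]]]]] := biembeddable_FD ind0 indw.
have [B TB AB] := opPhi A FDA; have [B' TB' AB'] := opPhi A' FDA'.
have [J BJ] := functor_embedding functor (@FD_copy n.+1) FDA FDA' Aj AB AB'.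
have [J' B'J] := functor_embedding functor (@FD_copy n.+1) FDA' FDA A'j AB' AB.
apply/nisoA/(embPhi A A' B B') => //.
exact: TFAb1_biembedding BJ B'J.
Qed.
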